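(* There are absolute constants $0<c_1\le c_2$ and a function $f:\mathbb{N}\to\mathbb{R}$ with $f(n)\to 0$ as $n\to\infty$ such that, for all integers $d,k\ge 1$, if $G$ is the $(d,k)$-grid and $n=(k+1)^d$, then for any vertex $s\in V(G)$, with probability at least $1-f(n)$, $$c_1\,dk\le h(\mathcal{T}(G,s))\le c_2\,dk .$$
   Context: The $(d,k)$-grid is the graph with vertex set $\{0,\dots,k\}^d$ in which two vertices are adjacent if and only if their Euclidean distance is $1$. For a connected graph $G$ on $n$ vertices and $s\in V(G)$, build random subtrees $T_1,\dots,T_n$ of $G$: $T_1$ is the single vertex $s$, and for $1<i\le n$, $T_i$ is obtained from $T_{i-1}$ by choosing, uniformly at random, an edge of $G$ with exactly one endpoint in $T_{i-1}$ and adding it (with its other endpoint) to $T_{i-1}$. The random spanning tree $T_n$, rooted at $s$, is denoted $\mathcal{T}(G,s)$. The height $h(T)$ of a rooted tree $T$ is the maximum number of edges on a root-to-leaf path. *)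

(* Defs.v *)
From HB Require Import structures.
From mathcomp Require Import all_boot all_order all_algebra.
From mathcomp Require Import reals.

Set Implicit Arguments.
Unset Strict Implicit.
Unset Printing Implicit Defensive.

Import Order.TTheory GRing.Theory Num.Theory.
Local Open Scope ring_scope.

(* A simple graph is given by its adjacency relation on a finType; an edge is
   the set of its two endpoints. *)
Definition edges (T : finType) (adj : rel T) : {set {set T}} :=
  [set [set p.1; p.2] | p : T * T & adj p.1 p.2].

(* A subgraph, as the pair of its vertex set and its edge set. *)
Definition subgraph (T : finType) : finType := ({set T} * {set {set T}})%type.

Definition boundary (T : finType) (adj : rel T) (t : subgraph T) :
    {set {set T}} :=
  [set b in edges adj | #|b :&: t.1| == 1%N].

Definition add_edge (T : finType) (t : subgraph T) (b : {set T}) : subgraph T :=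
  (t.1 :|: b, b |: t.2).

(* [growth_law R adj s i t] is the probability that T_(i+1) = t: the indices
   are shifted by one, so that T_1 = {s} corresponds to i = 0.  When the
   boundary is empty (for a connected graph: once all vertices are covered)
   there is no next tree and the mass is lost; the laws of T_1, ..., T_n, with
   n the number of vertices of a connected graph, are not affected. *)
Fixpoint growth_law (R : realType) (T : finType) (adj : rel T) (s : T)
    (i : nat) (t : subgraph T) : R :=
  if i is j.+1 then
    \sum_(u : subgraph T) growth_law R adj s j u *
      \sum_(b in boundary adj u)
        (add_edge u b == t)%:R / #|boundary adj u|%:R
  else (t == ([set s], set0))%:R.

(* The law of the random spanning tree T_n, n = #|T|. *)
Definition spanning_tree_law (R : realType) (T : finType) (adj : rel T) (s : T)
    (t : subgraph T) : R :=
  growth_law R adj s #|T|.-1 t.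

Definition spanning_tree_prob (R : realType) (T : finType) (adj : rel T) (s : T)
    (A : pred (subgraph T)) : R :=
  \sum_(t : subgraph T | A t) spanning_tree_law R adj s t.

Definition tree_adj (T : finType) (t : subgraph T) : rel T :=
  fun x y => [set x; y] \in t.2.

Definition tree_degree (T : finType) (t : subgraph T) (x : T) : nat :=
  #|[set y | tree_adj t x y]|.

(* The root is a leaf only in the one-vertex tree. *)
Definition leaf (T : finType) (s : T) (t : subgraph T) (x : T) : bool :=
  (x \in t.1) && (tree_degree t x == (x != s)).

(* [s :: p] is a path (without repeated vertices) from the root to a leaf; it
   has [size p] edges. *)
Definition root_leaf_path (T : finType) (s : T) (t : subgraph T) (p : seq T) :
    bool :=
  [&& path (tree_adj t) s p, uniq (s :: p) & leaf s t (last s p)].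

(* The bound [l < #|T|] is no restriction, since [uniq (s :: p)] forces
   [size p < #|T|]. *)
Definition height (T : finType) (s : T) (t : subgraph T) : nat :=
  \max_(l < #|T| | [exists p : l.-tuple T, root_leaf_path s t p]) l.

Definition grid_vertex (d k : nat) : finType := {ffun 'I_d -> 'I_k.+1}.

Definition eucl_dist (R : realType) (d k : nat) (x y : grid_vertex d k) : R :=
  Num.sqrt (\sum_(i < d) ((x i)%:R - (y i)%:R) ^+ 2).

Definition grid_adj (R : realType) (d k : nat) : rel (grid_vertex d k) :=
  fun x y => eucl_dist R x y == 1.

(* Main.v *)
From mathcomp Require Import all_classical all_reals all_analysis.
From mathcomp Require Import all_boot all_order all_algebra.
From mathcomp Require Import zify ring lra.
Require Import Defs.

(** Why the theorem holds.  Ring every edge of the grid by an independent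
    exponential clock of rate 1 and let an unreached vertex be reached when an
    edge joining it to a reached vertex rings: the trees T_1, ..., T_n are the
    successive states of this process (first-passage percolation).  The clocks
    only guide the intuition.  In the proof, time is hidden in functions of the
    set [A] of reached vertices: the rate at which such a potential [F]
    decreases on average per unit of time is [drift adj A F], a sum over the
    edges that leave [A].

    Lower bound.  Every tree that can occur spans the grid and consists of grid
    edges, so the path to a corner far from [s] has at least dk/2 edges, and it
    extends to a leaf ([grid_height_ge]).

    Upper bound.  There are at most (2d)^L paths of length L from [s], and one
    of them is traversed by time tau with probability at most tau^L / L!.
    Hence depths above C d tau are unlikely, and it is enough that each vertex
    is reached by a time tau of order k, up to a probability small compared
    with 1/n.  In terms of potentials: the sum of 2^length over all
    paths from the root grows at rate at most 4d ([path_sum_drift]), while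
    [reach_pot adj theta B s v] says that the expectation of exp(theta T) is at
    most B, where T is the time at which [v] is reached.  When theta is of
    order d, a weighted geometric mean of the two quantities, with a small
    fixed weight on the path sum, is a supermartingale, which bounds the
    depth of [v] ([endpoint_tail], [height_tail]).

    It remains to reach any [v] with theta of order d and log B of order dk
    ([grid_reach_pot]).  The walk from [s] to [v] is cut into 2k stages; a
    stage changes each coordinate of a set [W], about half of all coordinates,
    by at most one, and the bounds of successive stages multiply
    ([reach_pot_trans]).  In one stage only the vertices of a cube of
    dimension [#|W|] matter.  For each coordinate outside [W], moving it first
    and moving it back at the end gives a copy of this cube, and these order-d
    many copies are disjoint, so that the product of their potentials has a
    drift of order d times itself ([grid_stage]).

    All this rests on a bound, independent of the dimension m, on the expected
    time to reach a given vertex of the m-cube ([cube_pot_drift]).  Walking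
    greedily towards the target costs 1/h at distance h, in total log m.
    Instead, from the nearest reached vertex X at distance h, wait first for
    q^2 of its neighbours that are one step further away, then for q vertices
    that are one step back from such a neighbour, again at distance h; these
    have about q h neighbours at distance h - 1.  The three waits cost about
    q^2 / m, 1 / (q h) and 1 / (q h).  With q about (m / h)^(1/4) the sum over h
    is bounded ([level_sum_le]). *)

Set Implicit Arguments.
Unset Strict Implicit.
Unset Printing Implicit Defensive.

Import Order.TTheory GRing.Theory Num.Theory.
Import numFieldNormedType.Exports.
Local Open Scope ring_scope.

(** * Drift of a potential *)

Lemma sum_inj_le (R : realType) (I J : finType) (P : pred I) (D : {set J})
    (phi : J -> I) (g : I -> R) :
  {in D &, injective phi} -> (forall j, j \in D -> P (phi j)) ->
  (forall i, P i -> 0 <= g i) ->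
  \sum_(j in D) g (phi j) <= \sum_(i | P i) g i.
Proof.
move=> injphi Pphi g0; rewrite -(big_imset _ injphi) /=.
rewrite [leRHS](bigID [in phi @: D]) /= -[leLHS]addr0 lerD//; last first.
  by apply: sumr_ge0 => i /andP[/g0].
rewrite le_eqVlt; apply/orP; left; apply/eqP; apply: eq_bigl => i.
by apply/idP/andP => [/imsetP[j jD ->]|[]//]; rewrite Pphi// imset_f.
Qed.

(** The opposite of the generator of the growth process applied to [F]: each
    edge that leaves [A] rings at rate 1. *)
Definition drift (R : realType) (T : finType) (adj : rel T) (A : {set T})
    (F : {set T} -> R) : R :=
  \sum_(p : T * T | [&& p.1 \in A, p.2 \notin A & adj p.1 p.2])
    (F A - F (p.2 |: A)).

Definition antitone (R : realType) (T : finType) (F : {set T} -> R) :=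
  forall A B : {set T}, A \subset B -> F B <= F A.

Lemma antitone_drop (R : realType) (T : finType) (F : {set T} -> R)
    (A : {set T}) y : antitone F -> 0 <= F A - F (y |: A).
Proof. by move=> antiF; rewrite subr_ge0 antiF// subsetUr. Qed.

(** Lower bounds on drifts come from exhibiting many edges that leave [A] and
    decrease [F] substantially; by antitony the other edges do no harm. *)
Lemma drift_ge_card (R : realType) (T J : finType) (adj : rel T) (A : {set T})
    (F : {set T} -> R) (D : {set J}) (phi : J -> T * T) (c : R) :
  antitone F -> {in D &, injective phi} ->
  (forall j, j \in D ->
    [/\ (phi j).1 \in A, (phi j).2 \notin A, adj (phi j).1 (phi j).2 &
        c <= F A - F ((phi j).2 |: A)]) ->
  #|D|%:R * c <= drift adj A F.
Proof.
move=> antiF injphi Dphi.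
apply: le_trans (sum_inj_le injphi _ _); last first.
- by move=> p _; apply: antitone_drop.
- by move=> j /Dphi[-> -> ->].
by rewrite mulr_natl -sumr_const ler_sum// => j /Dphi[].
Qed.

(** * Costs of the levels of a cube *)

(** The parameter q of level [h], about (m / h)^(1/4).  The value 0 stands for
    a greedy descent, used at the last level and at distances comparable with
    the dimension, where it is cheap. *)
Definition spread (m h : nat) : nat :=
  if (h <= 1)%N || (m < 4 * h)%N then 0%N
  else \max_(q < m.+1 | (q ^ 4 * h <= m)%N) q.

Lemma spread_eq0 m h : spread m h = 0%N -> (h <= 1)%N || (m < 4 * h)%N.
Proof.
rewrite /spread; case: ifP => // /negbT; rewrite negb_or -!ltnNge ltnS.
case/andP=> h1 hm max0.
have m1 : (1 < m.+1)%N by lia.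
have := @leq_bigmax_cond _ (fun q : 'I_m.+1 => (q ^ 4 * h <= m)%N)
  (fun q : 'I_m.+1 => q : nat) (Ordinal m1).
by rewrite max0 /= exp1n mul1n => /(_ _); rewrite ltn0 => /(_ _)->//; lia.
Qed.

Lemma spread_gt0 m h : (0 < spread m h)%N ->
  [/\ (2 <= h)%N, (4 * h <= m)%N, (spread m h ^ 4 * h <= m)%N &
      (m < (2 * spread m h) ^ 4 * h)%N].
Proof.
rewrite /spread; case: ifP => // /negbT; rewrite negb_or -!ltnNge ltnS.
set s := \max_(_ < _ | _) _; case/andP=> h1 hm s0.
have [q0 q0P sE] : {q0 : 'I_m.+1 | (q0 ^ 4 * h <= m)%N & s = q0}.
  have [|q0 ? ?] := @eq_bigmax_cond _ (fun q : 'I_m.+1 => (q ^ 4 * h <= m)%N)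
    (fun q : 'I_m.+1 => q : nat); last by exists q0.
  by apply/card_gt0P; exists ord0; rewrite unfold_in /= exp0n.
split=> //; first by rewrite sE.
suff lt_m : (m < s.+1 ^ 4 * h)%N.
  by apply: leq_trans lt_m _; rewrite leq_mul2r leq_exp2r//; lia.
rewrite ltnNge; apply/negP => le_m.
have s1m : (s.+1 < m.+1)%N.
  have : (s.+1 ^ 1 <= s.+1 ^ 4)%N by rewrite leq_pexp2l.
  by rewrite expn1 ltnS; nia.
have := @leq_bigmax_cond _ (fun q : 'I_m.+1 => (q ^ 4 * h <= m)%N)
  (fun q : 'I_m.+1 => q : nat) (Ordinal s1m) le_m.
by rewrite -/s /= ltnn.
Qed.

(** The three costs bound the expected waiting times for one more neighbour
    further away, for one more vertex one step back from such a neighbour, and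
    for leaving the level downwards. *)
Definition up_cost (R : realType) (m : nat) : R := 4 / m%:R.

Definition side_cost (R : realType) (m h : nat) : R :=
  2 / (spread m h ^ 2 * h)%:R.

Definition down_cost (R : realType) (m h : nat) : R :=
  if spread m h == 0%N then h%:R^-1 else 2 / (spread m h * h)%:R.

(** The three phases of the descent from level [h]: [q ^ 2] steps up, [q] steps
    back to level [h], one step down. *)
Definition level_cost (R : realType) (m h : nat) : R :=
  up_cost R m * (spread m h ^ 2)%:R + side_cost R m h * (spread m h)%:R +
  down_cost R m h.

Lemma up_cost_ge0 (R : realType) m : 0 <= up_cost R m.
Proof. by rewrite divr_ge0. Qed.

Lemma side_cost_ge0 (R : realType) m h : 0 <= side_cost R m h.
Proof. by rewrite divr_ge0. Qed.

Lemma down_cost_gt0 (R : realType) m h : (0 < h)%N -> 0 < down_cost R m h.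
Proof.
move=> h0; rewrite /down_cost; case: eqP => [_|/eqP q0].
  by rewrite invr_gt0 ltr0n.
by rewrite divr_gt0// ltr0n muln_gt0 lt0n q0.
Qed.

Lemma level_cost_ge0 (R : realType) m h : (0 < h)%N -> 0 <= level_cost R m h.
Proof.
move=> h0; have a0 := up_cost_ge0 R m; have b0 := side_cost_ge0 R m h.
by have c0 := ltW (down_cost_gt0 R m h0); rewrite addr_ge0// addr_ge0// mulr_ge0.
Qed.

(** The four rate lemmas say that the number of edges available in a phase,
    times the cost of the phase, is at least 1: such a phase contributes at
    least 1 to the drift. *)
Lemma up_rate (R : realType) m h u : (0 < spread m h)%N ->
  (u < spread m h ^ 2)%N -> 1 <= (m - h - u)%:R * up_cost R m.
Proof.
move=> q0; have [h2 hm qm _] := spread_gt0 q0.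
set q := spread m h in q0 qm * => uq.
have qm2 : (2 * q ^ 2 <= m)%N by nia.
have m0 : (0 < m)%N by lia.
rewrite /up_cost mulrA ler_pdivlMr ?ltr0n// mul1r -natrM ler_nat; lia.
Qed.

Lemma side_rate (R : realType) m h n : (0 < spread m h)%N ->
  (spread m h ^ 2 * h <= n + spread m h)%N -> 1 <= n%:R * side_cost R m h.
Proof.
move=> q0; have [h2 hm qm _] := spread_gt0 q0.
set q := spread m h in q0 qm * => un.
have qq0 : (0 < q ^ 2 * h)%N by nia.
rewrite /side_cost -/q mulrA ler_pdivlMr ?ltr0n// mul1r -natrM ler_nat; nia.
Qed.

Lemma down_rate (R : realType) m h : (0 < spread m h)%N ->
  1 <= (spread m h * h.-1)%:R * down_cost R m h.
Proof.
move=> q0; have [h2 hm qm _] := spread_gt0 q0.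
rewrite /down_cost gtn_eqF//; set q := spread m h in q0 qm *.
have qq0 : (0 < q * h)%N by nia.
rewrite mulrA ler_pdivlMr ?ltr0n// mul1r -natrM ler_nat; nia.
Qed.

Lemma greedy_rate (R : realType) m h : (0 < h)%N -> spread m h = 0%N ->
  1 <= h%:R * down_cost R m h.
Proof.
by move=> h0 q0; rewrite /down_cost q0 eqxx mulfV// pnatr_eq0 -lt0n.
Qed.

(** The greedy cost is 1 at the last level and at most 4 / m at distances
    comparable with m.  Otherwise the cost is at most 8 / (q h), hence at most
    16 h^(-3/4) m^(-1/4), which is controlled by the increment of
    (h / m)^(1/4) between [h.-1] and [h]: the sum telescopes. *)
Lemma level_cost_le (R : realType) m h (rho := fun j : nat =>
    Num.sqrt (Num.sqrt (j%:R / m%:R : R))) : (0 < h <= m)%N ->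
  level_cost R m h <=
    (h == 1%N)%:R + 4 / m%:R + 64 * (rho h - rho h.-1).
Proof.
case/andP=> h0 hm.
have m0 : (0 : R) < m%:R by rewrite ltr0n; lia.
have rho_mono : rho h.-1 <= rho h.
  by rewrite /rho !ler_wsqrtr// ler_pM2r ?invr_gt0// ler_nat leq_pred.
have [q0|q0] := posnP (spread m h).
  rewrite /level_cost q0 !mulr0 !add0r /down_cost q0 eqxx.
  have : h%:R^-1 <= (h == 1%N)%:R + 4 / m%:R :> R.
    have [->|h1] := eqVneq h 1%N; first by rewrite invr1 lerDl divr_ge0.
    rewrite add0r ler_pdivlMr// mulrC ler_pdivrMr ?ltr0n// -natrM ler_nat.
    by have := spread_eq0 q0; lia.
  by lra.
have [h2 hm4 qm mq] := spread_gt0 q0.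
have c8 : level_cost R m h <= 8 / (spread m h * h)%:R.
  rewrite /level_cost /up_cost /side_cost /down_cost gtn_eqF//.
  set q := spread m h in q0 qm mq *.
  have qh0 : (0 : R) < (q * h)%:R by rewrite ltr0n muln_gt0 q0.
  have -> : 2 / (q ^ 2 * h)%:R * q%:R = 2 / (q * h)%:R :> R.
    rewrite !natrM; field.
    by rewrite !pnatr_eq0 -!lt0n q0 h0.
  have : 4 / m%:R * (q ^ 2)%:R <= 4 / (q * h)%:R :> R.
    rewrite mulrAC ler_pdivrMr// mulrAC ler_pdivlMr// -!natrM ler_nat; nia.
  set z := (_ : R)^-1; lra.
set q := spread m h in q0 qm mq c8 *.
have qh0 : (0 : R) < (q * h)%:R by rewrite ltr0n muln_gt0 q0.
suff : 8 / (q * h)%:R <= 64 * (rho h - rho h.-1).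
  have : (0 : R) <= (h == 1%N)%:R + 4 / m%:R by rewrite addr_ge0// divr_ge0// ltW.
  by lra.
have rho4 j : rho j ^+ 4 = j%:R / m%:R.
  by rewrite /rho (exprM _ 2 2) !sqr_sqrtr ?sqrtr_ge0// divr_ge0.
have rho0 j : 0 <= rho j by apply: sqrtr_ge0.
have a0 : 0 < rho h by rewrite /rho !sqrtr_gt0 divr_gt0// ltr0n.
have dif : (rho h ^+ 4 - rho h.-1 ^+ 4) * m%:R = 1.
  by rewrite !rho4 -mulrBl divfK ?gt_eqF// -natrB ?leq_pred// -subn1 subKn.
(* a^4 - b^4 = (a - b) (a^3 + a^2 b + a b^2 + b^3) <= 4 (a - b) a^3 *)
have le4 : 1 <= 4 * (rho h - rho h.-1) * rho h ^+ 3 * m%:R.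
  rewrite -[leLHS]dif; apply: ler_wpM2r; first exact: ltW.
  have := rho0 h.-1; move: rho_mono a0; set a := rho h; set b := rho h.-1.
  move=> ba a0 b0.
  have -> : a ^+ 4 - b ^+ 4 = (a - b) * (a^+3 + a^+2 * b + a * b^+2 + b^+3).
    by ring.
  rewrite [leRHS](_ : _ = (a - b) * (4 * a ^+ 3)); last by ring.
  apply: ler_wpM2l; first by rewrite subr_ge0.
  have b2 : b ^+ 2 <= a ^+ 2 by rewrite lerXn2r ?nnegrE// ltW.
  have b3 : b ^+ 3 <= a ^+ 3 by rewrite lerXn2r ?nnegrE// ltW.
  have : a ^+ 2 * b <= a ^+ 3 by rewrite [leRHS]exprSr ler_pM2l// exprn_gt0.
  have : a * b ^+ 2 <= a ^+ 3 by rewrite [leRHS]exprS ler_pM2l.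
  by rewrite mulrC; lra.
(* maximality of q, in the form m < (2 q)^4 h *)
have q2 : 1 <= 2 * q%:R * rho h.
  have [//|lt1] := leP 1 (2 * q%:R * rho h).
  have : (2 * q%:R * rho h) ^+ 4 < 1.
    by rewrite exprn_ilt1// mulr_ge0// ?mulr_ge0// ltW.
  rewrite exprMn rho4 mulrA ltr_pdivrMr// mul1r -natrM -natrX -natrM ltr_nat.
  by rewrite ltnNge ltnW.
rewrite ler_pdivrMr// natrM.
have hE : h%:R = rho h ^+ 4 * m%:R by rewrite rho4 divfK// gt_eqF.
have step : 1 * 1 <= (2 * q%:R * rho h) * (4 * (rho h - rho h.-1) * rho h ^+ 3 * m%:R).
  by apply: ler_pM.
rewrite hE; apply: le_trans (_ : 8 * ((2 * q%:R * rho h) * (4 * (rho h - rho h.-1) * rho h ^+ 3 * m%:R)) <= _).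
  by lra.
by rewrite le_eqVlt; apply/orP; left; apply/eqP; ring.
Qed.

Definition level_sum (R : realType) (m h : nat) : R :=
  \sum_(1 <= j < h.+1) level_cost R m j.

Lemma level_sumS (R : realType) m h : (0 < h)%N ->
  level_sum R m h = level_sum R m h.-1 + level_cost R m h.
Proof. by case: h => // h _; rewrite /level_sum big_nat_recr. Qed.

Lemma level_sum_homo (R : realType) m a b : (a <= b)%N ->
  level_sum R m a <= level_sum R m b.
Proof.
elim: b => [|b IHb]; first by rewrite leqn0 => /eqP ->.
rewrite leq_eqVlt ltnS => /predU1P[->//|/IHb /le_trans->//].
by rewrite (@level_sumS _ _ b.+1)//= lerDl level_cost_ge0.
Qed.

Lemma level_sum_ge0 (R : realType) m h : 0 <= level_sum R m h.
Proof.
apply: le_trans (level_sum_homo _ _ (leq0n h)).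
by rewrite /level_sum big_geq.
Qed.

Lemma level_sum_le (R : realType) m h : (h <= m)%N -> level_sum R m h <= 69.
Proof.
have [->|m0] := posnP m; first by rewrite leqn0 => /eqP ->; rewrite /level_sum big_geq.
pose rho (j : nat) := Num.sqrt (Num.sqrt (j%:R / m%:R : R)).
suff H : (h <= m)%N -> level_sum R m h <=
    (0 < h)%:R + 4 * h%:R / m%:R + 64 * rho h.
  move=> hm; apply: le_trans (H hm) _.
  have m0R : (0 : R) < m%:R by rewrite ltr0n.
  have r1 : rho h <= 1.
    rewrite -[leRHS]sqrtr1 ler_wsqrtr// -[leRHS]sqrtr1 ler_wsqrtr//.
    by rewrite ler_pdivrMr// mul1r ler_nat.
  have : 4 * h%:R / m%:R <= 4 :> R by rewrite ler_pdivrMr// ler_pM2l// ler_nat.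
  have : (0 < h)%:R <= 1 :> R by case: (0 < h)%N.
  by lra.
elim: h => [_|h IHh hm].
  by rewrite /level_sum big_geq// mulr0 mul0r !add0r mulr_ge0// sqrtr_ge0.
rewrite level_sumS//=; have := IHh (ltnW hm).
have := @level_cost_le R m h.+1; rewrite hm/= => /(_ isT).
rewrite -!/(rho _) eqSS.
have -> : (0 < h.+1)%:R = (h == 0)%:R + (0 < h)%:R :> R.
  by case: h {IHh hm} => [|h] /=; rewrite ?addr0 ?add0r.
have -> : 4 * h.+1%:R / m%:R = 4 * h%:R / m%:R + 4 / m%:R :> R.
  by rewrite -addn1 natrD; ring.
lra.
Qed.

(** * Reaching a vertex of a cube in bounded expected time *)

(** Vertices of the cube are the subsets of [W]. *)
Definition cube_adj (I : finType) (W : {set I}) : rel {set I} := fun X Y =>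
  [&& X \subset W, Y \subset W &
      [exists i in W, (X :\ i == Y :\ i) && ((i \in X) != (i \in Y))]].

Definition up_nbrs (I : finType) (W : {set I}) (A : {set {set I}}) (X : {set I}) :
    {set I} :=
  [set j in W :\: X | j |: X \in A].

(** Reached vertices at the same distance as [X] from the empty set, and at
    distance two from [X]. *)
Definition swap_nbrs (I : finType) (W : {set I}) (A : {set {set I}})
    (X : {set I}) : {set I * I} :=
  [set p | [&& p.1 \in W :\: X, p.2 \in X & p.1 |: (X :\ p.2) \in A]].

(** A bound on the expected time to reach the empty set when [X] is the nearest
    reached vertex: the costs of the lower levels and what remains to be paid
    at the level of [X].  Truncated subtraction makes a completed phase free. *)
Definition cell_pot (R : realType) (I : finType) (W : {set I})
    (A : {set {set I}}) (X : {set I}) : R :=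
  if X == finset.set0 then 0 else
  level_sum R #|W| #|X|.-1 +
  (up_cost R #|W| * (spread #|W| #|X| ^ 2 - #|up_nbrs W A X|)%:R +
   side_cost R #|W| #|X| * (spread #|W| #|X| - #|swap_nbrs W A X|)%:R +
   down_cost R #|W| #|X|).

(** Taking the minimum over all reached vertices makes the potential antitone.
    It is attained at a nearest vertex, since the levels below [X] cost less
    than [cell_pot] at [X]. *)
Definition cube_pot (R : realType) (I : finType) (W : {set I})
    (A : {set {set I}}) : R :=
  \big[Num.min/69]_(X in A | X \subset W) cell_pot R W A X.

Lemma cell_pot_ge (R : realType) (I : finType) (W : {set I}) A (X : {set I}) :
  X != finset.set0 ->
  level_sum R #|W| #|X|.-1 + down_cost R #|W| #|X| <= cell_pot R W A X.
Proof.
move=> X0; rewrite /cell_pot (negPf X0) lerD2l lerDr addr_ge0// mulr_ge0//.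
  exact: up_cost_ge0.
exact: side_cost_ge0.
Qed.

Lemma cell_pot_le (R : realType) (I : finType) (W : {set I}) A (X : {set I}) :
  cell_pot R W A X <= level_sum R #|W| #|X|.
Proof.
rewrite /cell_pot; case: ifP => [_|/negbT X0]; first exact: level_sum_ge0.
rewrite [leRHS]level_sumS ?card_gt0// lerD2l /level_cost lerD2r lerD//.
  by apply: ler_wpM2l; rewrite ?up_cost_ge0// ler_nat leq_subr.
by apply: ler_wpM2l; rewrite ?side_cost_ge0// ler_nat leq_subr.
Qed.

Lemma cell_pot_ge0 (R : realType) (I : finType) (W : {set I}) A (X : {set I}) :
  0 <= cell_pot R W A X.
Proof.
have [->|X0] := eqVneq X finset.set0; first by rewrite /cell_pot eqxx.
apply: le_trans (cell_pot_ge R W A X0).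
by rewrite addr_ge0 ?level_sum_ge0// ltW// down_cost_gt0// card_gt0.
Qed.

Lemma cell_pot_le69 (R : realType) (I : finType) (W : {set I}) A (X : {set I}) :
  X \subset W -> cell_pot R W A X <= 69.
Proof.
by move=> XW; rewrite (le_trans (cell_pot_le _ _ _ _))// level_sum_le// subset_leq_card.
Qed.

Lemma up_nbrsS (I : finType) (W : {set I}) (A B : {set {set I}}) X :
  A \subset B -> up_nbrs W A X \subset up_nbrs W B X.
Proof.
move=> /subsetP AB; apply/subsetP => j; rewrite !inE => /andP[-> /AB ->] //.
Qed.

Lemma swap_nbrsS (I : finType) (W : {set I}) (A B : {set {set I}}) X :
  A \subset B -> swap_nbrs W A X \subset swap_nbrs W B X.
Proof.
by move=> /subsetP AB; apply/subsetP => j; rewrite !inE => /and3P[-> -> /AB ->].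
Qed.

Lemma cell_pot_anti (R : realType) (I : finType) (W : {set I}) X :
  antitone (fun A => cell_pot R W A X).
Proof.
move=> A B AB; rewrite /cell_pot; case: ifP => // _.
rewrite lerD2l lerD2r lerD//.
  apply: ler_wpM2l; rewrite ?up_cost_ge0// ler_nat leq_sub2l//.
  exact/subset_leq_card/up_nbrsS.
apply: ler_wpM2l; rewrite ?side_cost_ge0// ler_nat leq_sub2l//.
exact/subset_leq_card/swap_nbrsS.
Qed.

Lemma cube_pot_ge0 (R : realType) (I : finType) (W : {set I}) A :
  0 <= cube_pot R W A.
Proof. by apply: le_bigmin => // X _; apply: cell_pot_ge0. Qed.

Lemma cube_pot_le (R : realType) (I : finType) (W : {set I}) A :
  cube_pot R W A <= 69.
Proof. exact: bigmin_le_id. Qed.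

Lemma cube_pot_le_cell (R : realType) (I : finType) (W : {set I})
    (A : {set {set I}}) (X : {set I}) :
  X \in A -> X \subset W -> cube_pot R W A <= cell_pot R W A X.
Proof. by move=> XA XW; apply: bigmin_le_cond; rewrite XA. Qed.

Lemma cube_pot_anti (R : realType) (I : finType) (W : {set I}) :
  antitone (@cube_pot R I W).
Proof.
move=> A B AB; apply/bigmin_geP; split; first exact: cube_pot_le.
move=> X /andP[XA XW]; apply: le_trans (cube_pot_le_cell _ _ XW) _.
  exact: (subsetP AB).
exact: cell_pot_anti.
Qed.

Lemma card_dep_pairs (I J : finType) (S : {set I}) (f : I -> {set J}) :
  #|[set p : I * J | (p.1 \in S) && (p.2 \in f p.1)]| =
  (\sum_(i in S) #|f i|)%N.
Proof.
under eq_bigr do rewrite -sum1_card.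
rewrite pair_big_dep /= -sum1_card; apply: eq_bigl => p; by rewrite inE.
Qed.

Lemma swap_inj (I : finType) (X : {set I}) j i j' i' :
  j \notin X -> j' \notin X -> i \in X -> i' \in X ->
  j |: (X :\ i) = j' |: (X :\ i') -> j = j' /\ i = i'.
Proof.
move=> jX j'X iX i'X /setP E; split.
  by have := E j; rewrite !inE eqxx (negPf jX) !andbF /=; case: eqP.
have := E i; rewrite !inE eqxx /= iX andbT.
have /negPf-> : i != j by apply: contraNneq jX => <-.
have /negPf-> : i != j' by apply: contraNneq j'X => <-.
by move=> /= /esym/negbFE/eqP.
Qed.

Lemma cube_adj_up (I : finType) (W X : {set I}) j :
  X \subset W -> j \in W :\: X -> cube_adj W X (j |: X).
Proof.
move=> XW; rewrite inE => /andP[jX jW]; rewrite /cube_adj XW subUset sub1set jW XW/=.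
apply/existsP; exists j; rewrite jW /= setU11 (negPf jX) andbT.
by rewrite setU1K// (setDidPl _)// disjoint_sym disjoints1.
Qed.

Lemma cube_adj_down (I : finType) (W X : {set I}) i :
  X \subset W -> i \in X -> cube_adj W X (X :\ i).
Proof.
move=> XW iX; rewrite /cube_adj XW (subset_trans _ XW) ?subD1set//=.
apply/existsP; exists i; rewrite (subsetP XW)// setD11 iX andbT.
apply/eqP/setP => j; rewrite !inE; by case: (j == i).
Qed.

(** The expected time to reach the empty set from [X0] is at most 69, whatever
    the dimension.  Let X be a vertex where the minimum is attained.  No vertex
    nearer to the target is reached, so every edge towards one leaves [A]; in
    each phase the edges that advance the phase are numerous enough. *)
Lemma cube_pot_drift (R : realType) (I : finType) (W : {set I})
    (A : {set {set I}}) (X0 : {set I}) :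
  X0 \in A -> X0 \subset W -> finset.set0 \notin A ->
  1 <= drift (cube_adj W) A (@cube_pot R I W).
Proof.
move=> X0A X0W A0.
have [||X /andP[XA XW] FX] := @eq_bigmin _ _ _ 69 X0
    (fun X => (X \in A) && (X \subset W)) (cell_pot R W A).
- by rewrite X0A.
- by move=> X /andP[_]; exact: cell_pot_le69.
rewrite -/(cube_pot R W A) in FX.
have Xn0 : X != finset.set0 by apply: contraNneq A0 => <-.
have h0 : (0 < #|X|)%N by rewrite card_gt0.
have Xmin Y : Y \in A -> Y \subset W -> (#|X| <= #|Y|)%N.
  move=> YA YW; rewrite leqNgt; apply/negP => ltYX.
  have := cube_pot_le_cell R YA YW; rewrite FX => /le_trans/(_ (cell_pot_le _ _ _ _)).
  move=> /(le_trans (cell_pot_ge _ _ _ Xn0)).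
  have : level_sum R #|W| #|Y| <= level_sum R #|W| #|X|.-1.
    by apply: level_sum_homo; rewrite -ltnS prednK.
  by have := down_cost_gt0 R #|W| h0; lra.
have low (Y : {set I}) : Y \subset W -> (#|Y| < #|X|)%N -> Y \notin A.
  by move=> YW; rewrite ltnNge; apply: contra => YA; apply: Xmin.
have reach (Y : {set I}) : Y \subset W -> (#|Y| < #|X|)%N ->
    down_cost R #|W| #|X| <= cube_pot R W A - cube_pot R W (Y |: A).
  move=> YW YX.
  have : cube_pot R W (Y |: A) <= level_sum R #|W| #|X|.-1.
    apply: le_trans (cube_pot_le_cell _ (setU11 _ _) YW) _.
    apply: le_trans (cell_pot_le _ _ _ _) _.
    by apply: level_sum_homo; rewrite -ltnS prednK.
  by rewrite FX; have := cell_pot_ge R W A Xn0; lra.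
have XYA (Y : {set I}) : X \in Y |: A by rewrite inE XA orbT.
have better (Y : {set I}) : cube_pot R W A - cube_pot R W (Y |: A) >=
    cell_pot R W A X - cell_pot R W (Y |: A) X.
  by rewrite FX lerD2l lerN2 cube_pot_le_cell.
(* greedy level: every element of X may be removed *)
have [q0|q0] := posnP (spread #|W| #|X|).
  apply: le_trans (greedy_rate R h0 q0) _.
  apply: (@drift_ge_card _ _ _ _ _ _ X (fun i => (X, X :\ i))).
  - exact: cube_pot_anti.
  - move=> i j iX jX [] /setP/(_ i); rewrite !inE eqxx iX !andbT /=.
    by move=> /esym/negbFE/eqP.
  move=> i iX /=; have YW : X :\ i \subset W by rewrite (subset_trans _ XW) ?subD1set.
  have YX : (#|X :\ i| < #|X|)%N by rewrite [ltnRHS](cardsD1 i) iX.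
  by split; rewrite ?low ?reach// cube_adj_down.
(* first phase: add to X an element outside X *)
have [uq|qu] := ltnP #|up_nbrs W A X| (spread #|W| #|X| ^ 2).
  apply: le_trans (up_rate R q0 uq) _.
  have <- : #|[set j in W :\: X | j |: X \notin A]| =
      (#|W| - #|X| - #|up_nbrs W A X|)%N.
    have -> : [set j in W :\: X | j |: X \notin A] = (W :\: X) :\: up_nbrs W A X.
      by apply/setP => j; rewrite !inE; case: (j \in X); case: (j \in W); rewrite ?andbT ?andbF.
    rewrite cardsD (setIidPr _) ?cardsD ?(setIidPr XW)//.
    by apply/subsetP => j; rewrite inE => /andP[].
  apply: (@drift_ge_card _ _ _ _ _ _ _ (fun j => (X, j |: X))).
  - exact: cube_pot_anti.
  - move=> i j; rewrite !inE -!andbA => /and3P[iX _ _] _ [] /setP/(_ i).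
    by rewrite !inE eqxx (negPf iX) /=; case: eqP.
  move=> j; rewrite inE => /andP[jWX jA] /=; split => //.
    exact: cube_adj_up.
  apply: le_trans _ (better _); rewrite /cell_pot (negPf Xn0).
  set w := #|swap_nbrs _ A _|; set w' := #|swap_nbrs _ _ _|.
  set u := #|up_nbrs _ A _| in uq *; set u' := #|up_nbrs _ _ _|.
  have ww' : (w <= w')%N by apply/subset_leq_card/swap_nbrsS/subsetUr.
  have uu' : (u < u')%N.
    apply: proper_card; apply/properP; split; first exact/up_nbrsS/subsetUr.
    exists j; first by move: jWX; rewrite !inE eqxx andbT.
    by rewrite inE (negPf jA) andbF.
  have b0 := side_cost_ge0 R #|W| #|X|; have a0 := up_cost_ge0 R #|W|.
  have : side_cost R #|W| #|X| * (spread #|W| #|X| - w')%:R <=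
         side_cost R #|W| #|X| * (spread #|W| #|X| - w)%:R.
    by apply: ler_wpM2l => //; rewrite ler_nat leq_sub2l.
  have : up_cost R #|W| * ((spread #|W| #|X| ^ 2 - u')%:R + 1) <=
         up_cost R #|W| * (spread #|W| #|X| ^ 2 - u)%:R.
    by apply: ler_wpM2l => //; rewrite natr1 ler_nat ltn_sub2l.
  by rewrite mulrDr mulr1; lra.
(* second phase: of the at least q^2 h edges down from the neighbours of X,
   fewer than q have been used *)
have [wq|qw] := ltnP #|swap_nbrs W A X| (spread #|W| #|X|).
  pose D := [set p : I * I | [&& p.1 \in up_nbrs W A X, p.2 \in X &
                              p.1 |: (X :\ p.2) \notin A]].
  apply: le_trans (_ : #|D|%:R * side_cost R #|W| #|X| <= _).
    apply: side_rate => //.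
    apply: leq_trans (_ : #|setX (up_nbrs W A X) X| <= _)%N.
      by rewrite cardsX leq_mul.
    apply: leq_trans (_ : #|D| + #|swap_nbrs W A X| <= _)%N; last first.
      by rewrite leq_add2l ltnW.
    apply: leq_trans (_ : #|D :|: swap_nbrs W A X| <= _)%N; last first.
      by rewrite cardsU leq_subr.
    apply/subset_leq_card/subsetP => p; rewrite !inE => /andP[/andP[/andP[-> ->] ->] ->] /=.
    by rewrite orNb.
  apply: (@drift_ge_card _ _ _ _ _ _ _
    (fun p => (p.1 |: X, p.1 |: (X :\ p.2)))).
  - exact: cube_pot_anti.
  - move=> [j i] [j' i']; rewrite !inE /= -!andbA.
    case/and5P=> jX _ _ iX _ /and5P[j'X _ _ i'X _] [_ E].
    by have [-> ->] := swap_inj jX j'X iX i'X E.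
  move=> [j i]; rewrite inE => /and3P[/= ju iX yA].
  move: (ju); rewrite inE => /andP[jWX jXA].
  have [jX jW] : j \notin X /\ j \in W by move: jWX; rewrite !inE => /andP[].
  have ij : i != j by apply: contraNneq jX => <-.
  split => //.
    have -> : j |: (X :\ i) = (j |: X) :\ i.
      by apply/setP => k; rewrite !inE; case: eqP => // ->; rewrite eq_sym ij.
    by apply: cube_adj_down; rewrite ?subUset ?sub1set ?jW// inE iX orbT.
  apply: le_trans _ (better _); rewrite /cell_pot (negPf Xn0).
  set w := #|swap_nbrs _ A _| in wq *; set w' := #|swap_nbrs _ _ _|.
  set u := #|up_nbrs _ A _|; set u' := #|up_nbrs _ _ _|.
  have uu' : (u <= u')%N by apply/subset_leq_card/up_nbrsS/subsetUr.
  have ww' : (w < w')%N.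
    apply: proper_card; apply/properP; split; first exact/swap_nbrsS/subsetUr.
    exists (j, i); first by rewrite !inE /= jX jW iX eqxx.
    by rewrite inE (negPf yA) !andbF.
  have b0 := side_cost_ge0 R #|W| #|X|; have a0 := up_cost_ge0 R #|W|.
  have : side_cost R #|W| #|X| * ((spread #|W| #|X| - w')%:R + 1) <=
         side_cost R #|W| #|X| * (spread #|W| #|X| - w)%:R.
    by apply: ler_wpM2l => //; rewrite natr1 ler_nat ltn_sub2l.
  have : up_cost R #|W| * (spread #|W| #|X| ^ 2 - u')%:R <=
         up_cost R #|W| * (spread #|W| #|X| ^ 2 - u)%:R.
    by apply: ler_wpM2l => //; rewrite ler_nat leq_sub2l.
  by rewrite mulrDr mulr1; lra.
(* last phase: each of the q vertices of the second phase has h - 1 edges down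
   that remove a further element of X *)
pose D := [set p : (I * I) * I | (p.1 \in swap_nbrs W A X) &&
                                 (p.2 \in X :\ p.1.2)].
apply: le_trans (_ : #|D|%:R * down_cost R #|W| #|X| <= _).
  apply: le_trans (down_rate R q0) _; apply: ler_wpM2r.
    exact/ltW/down_cost_gt0.
  rewrite ler_nat (card_dep_pairs _ (fun p : I * I => X :\ p.2)) (eq_bigr (fun=> #|X|.-1)); last first.
    by move=> [j i]; rewrite inE => /and3P[_ /= iX _]; rewrite [in RHS](cardsD1 i) iX.
  by rewrite sum_nat_const leq_mul.
apply: (@drift_ge_card _ _ _ _ _ _ _
  (fun p => (p.1.1 |: (X :\ p.1.2), (p.1.1 |: (X :\ p.1.2)) :\ p.2))).
- exact: cube_pot_anti.
- move=> [[j i] k] [[j' i'] k']; rewrite !inE /= -!andbA.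
  case/and5P=> jX _ iX _ /andP[ki kX] /and5P[j'X _ i'X _ /andP[k'i' k'X]] [E E2].
  have [ej ei] := swap_inj jX j'X iX i'X E; subst j' i'.
  congr (_, _); move/setP: E2 => /(_ k); rewrite !inE eqxx kX ki /= ?orbT ?andbT.
  by move=> /esym/negbFE/eqP.
move=> [[j i] k]; rewrite !inE /= -!andbA.
case/and5P=> jX jW iX YA /andP[ki kX].
have YW : j |: (X :\ i) \subset W.
  by rewrite subUset sub1set jW (subset_trans _ XW) ?subD1set.
have kY : k \in j |: (X :\ i) by rewrite !inE ki kX orbT.
have ZW : (j |: (X :\ i)) :\ k \subset W by rewrite (subset_trans _ YW) ?subD1set.
have ZX : (#|(j |: (X :\ i)) :\ k| < #|X|)%N.
  have <- : #|j |: (X :\ i)| = #|X|.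
    by rewrite cardsU1 !inE (negPf jX) andbF [RHS](cardsD1 i) iX.
  by rewrite [ltnRHS](cardsD1 k) kY.
by split; rewrite ?low ?reach// cube_adj_down.
Qed.

(** * Exponential potentials and their composition *)

(** A certificate that the expectation of exp (theta T) is at most [B], where T
    is the time at which [t] is reached from [s]: exp (theta time) * F A is a
    supermartingale until then, and F is at least 1 when it stops. *)
Definition reach_pot (R : realType) (T : finType) (adj : rel T) (theta B : R)
    (s t : T) : Prop :=
  exists F : {set T} -> R,
    [/\ antitone F, forall A, 1 <= F A <= B &
        forall A : {set T}, s \in A -> t \notin A ->
          theta * F A <= drift adj A F].

Lemma reach_pot_refl (R : realType) (T : finType) (adj : rel T) (theta : R) s :
  reach_pot adj theta 1 s s.
Proof.
exists (fun=> 1); split=> [A B _|A|A sA]; rewrite ?lexx//.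
by rewrite sA.
Qed.

(** Strong Markov property at the time when [w] is reached: the further
    vertices reached by then only help, because potentials are antitone. *)
Lemma reach_pot_trans (R : realType) (T : finType) (adj : rel T)
    (theta B1 B2 : R) s w t :
  reach_pot adj theta B1 s w -> reach_pot adj theta B2 w t ->
  reach_pot adj theta (B1 * B2) s t.
Proof.
move=> [F1 [anti1 bnd1 drift1]] [F2 [anti2 bnd2 drift2]].
have F1ge A : 1 <= F1 A by case/andP: (bnd1 A).
have F1le A : F1 A <= B1 by case/andP: (bnd1 A).
have F2ge A : 1 <= F2 A by case/andP: (bnd2 A).
have F2le A : F2 A <= B2 by case/andP: (bnd2 A).
have B1_1 : 1 <= B1 by apply: le_trans (F1ge finset.set0) (F1le _).
have B2_1 : 1 <= B2 by apply: le_trans (F2ge finset.set0) (F2le _).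
have B2_F1 A : B2 <= B2 * F1 A by rewrite ler_peMr// (le_trans _ B2_1).
exists (fun A : {set T} => if w \in A then F2 A else B2 * F1 A); split.
- move=> A B AB /=; case: ifP => wB; case: ifP => wA.
  + exact: anti2.
  + exact: le_trans (F2le _) (B2_F1 _).
  + by rewrite (subsetP AB) in wB.
  + by rewrite ler_pM2l ?anti1// (lt_le_trans _ B2_1).
- move=> A; case: ifP => _; apply/andP; split.
  + exact: F2ge.
  + by rewrite (le_trans (F2le A))// ler_peMl// (le_trans _ B2_1).
  + exact: le_trans (B2_F1 A).
  + by rewrite mulrC ler_pM2r// (lt_le_trans _ B2_1).
- move=> A sA tA; case: ifP => wA.
    apply: le_trans (drift2 A wA tA) _; rewrite /drift wA; apply: ler_sum => p _.
    by rewrite inE wA orbT.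
  rewrite mulrCA; apply: le_trans (_ : B2 * drift adj A F1 <= _).
    by rewrite ler_pM2l ?drift1 ?wA// (lt_le_trans _ B2_1).
  rewrite /drift wA mulr_sumr; apply: ler_sum => p _.
  rewrite mulrBr lerD2l lerN2; case: ifP => // _.
  exact: le_trans (F2le _) (B2_F1 _).
Qed.

Lemma reach_pot_chain (R : realType) (T : finType) (adj : rel T) (theta B : R)
    (w : nat -> T) n :
  (forall j, (j < n)%N -> reach_pot adj theta B (w j) (w j.+1)) ->
  reach_pot adj theta (B ^+ n) (w 0%N) (w n).
Proof.
elim: n => [_|n IHn step]; first by rewrite expr0; exact: reach_pot_refl.
rewrite exprSr; apply: (reach_pot_trans (w := w n)); last exact: step.
by apply: IHn => j jn; apply: step; apply: ltnW.
Qed.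

Lemma reach_pot_widen (R : realType) (T : finType) (adj : rel T)
    (theta theta' B B' : R) s t :
  theta' <= theta -> B <= B' ->
  reach_pot adj theta B s t -> reach_pot adj theta' B' s t.
Proof.
move=> le_th le_B [F [antiF bndF driftF]]; exists F; split=> // [A|A sA tA].
  by case/andP: (bndF A) => -> /le_trans->.
apply: le_trans (driftF A sA tA); rewrite ler_pM2r//.
by case/andP: (bndF A) => /(lt_le_trans ltr01).
Qed.

(** * Adjacency in the grid *)

Definition near_val (k : nat) (a b : 'I_k.+1) : bool :=
  (a.+1 == b :> nat) || (b.+1 == a :> nat).

Lemma sqrn_eq1 (n : nat) : (n ^ 2 == 1)%N = (n == 1)%N.
Proof. by rewrite -[1%N in LHS](exp1n 2) eqn_exp2r. Qed.

Lemma sqr_dist_eq1 (a b : nat) :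
  ((a - b) ^ 2 + (b - a) ^ 2)%N = 1%N -> (a.+1 == b) || (b.+1 == a).
Proof.
case: (leqP a b) => ab.
  by rewrite (eqP ab) exp0n// add0n => /eqP; rewrite sqrn_eq1; lia.
rewrite (_ : b - a = 0)%N; last by lia.
by rewrite exp0n// addn0 => /eqP; rewrite sqrn_eq1; lia.
Qed.

(** The squared distance is a sum of squares of integers, and such a sum is 1
    only if one square is 1 and the others are 0. *)
Lemma grid_adjP (R : realType) (d k : nat) (x y : grid_vertex d k) :
  reflect (exists2 i, near_val (x i) (y i) & forall j, j != i -> x j = y j)
    (grid_adj R x y).
Proof.
pose dif (i : 'I_d) := ((x i - y i) ^ 2 + (y i - x i) ^ 2)%N.
have -> : grid_adj R x y = (\sum_i dif i == 1)%N.
  rewrite /grid_adj /eucl_dist.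
  have -> : \sum_(i < d) ((x i)%:R - (y i)%:R) ^+ 2 = (\sum_i dif i)%:R :> R.
    rewrite natr_sum; apply: eq_bigr => i _; rewrite /dif natrD.
    case: (leqP (x i) (y i)) => xy.
      by rewrite (eqP xy) add0r natrX natrB// -sqrrN opprB.
    have /eqP -> : (y i - x i == 0)%N by exact: ltnW.
    by rewrite addr0 natrX natrB// ltnW.
  set n := (\sum_i dif i)%N.
  rewrite -[X in _ == X]sqrtr1 eqr_sqrt//.
  by rewrite -[X in _ == X](@mulr1n R 1) eqr_nat.
apply: (iffP idP) => [/eqP /esym E|[i near_i eq_j]]; last first.
  rewrite (bigD1 i)//= big1 => [|j /eq_j]; last by rewrite /dif => ->; rewrite subnn.
  by rewrite /dif addn0; move: near_i; rewrite /near_val => /orP[]/eqP; lia.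
have [i di] : exists i, dif i != 0%N.
  apply/existsP; rewrite -negb_forall; apply/negP => /forallP dif0.
  by move: E; rewrite big1// => i _; apply/eqP.
move: E; rewrite (bigD1 i)//= => E; exists i.
  have : dif i = 1%N by lia.
  by move=> di1; apply: sqr_dist_eq1.
move=> j ji; have : (\sum_(i0 < d | i0 != i) dif i0 == 0)%N.
  by move: E di; set S := (\sum_(_ < _ | _) _)%N; case: (dif i) => //; case: S => // *; lia.
rewrite sum_nat_eq0 => /forallP/(_ j); rewrite ji /= => /eqP.
rewrite /dif => /eqP; rewrite addn_eq0 !expn_eq0 !subn_eq0 !andbT -eqn_leq.
by move=> /eqP/val_inj.
Qed.

(** * One stage: parallel copies of a cube *)

Definition other_val (k : nat) (a : 'I_k.+1) : 'I_k.+1 :=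
  if a == 0%N :> nat then inord 1 else inord a.-1.

Lemma near_val_sym (k : nat) (a b : 'I_k.+1) : near_val a b = near_val b a.
Proof. by rewrite /near_val orbC. Qed.

Lemma near_val_neq (k : nat) (a b : 'I_k.+1) : near_val a b -> a != b.
Proof. by apply: contraTneq => ->; rewrite /near_val !gtn_eqF. Qed.

Lemma near_other_val (k : nat) (a : 'I_k.+1) : (0 < k)%N -> near_val a (other_val a).
Proof.
move=> k0; rewrite /near_val /other_val.
have [a0|a0] := eqVneq (a : nat) 0%N; first by rewrite a0 inordK.
have ak := ltn_ord a; rewrite inordK; last by rewrite (leq_ltn_trans (leq_pred _)).
by rewrite prednK ?eqxx ?orbT// lt0n.
Qed.

Lemma sum_ge_term (R : realType) (I : finType) (P : pred I) (g : I -> R) i0 :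
  P i0 -> (forall i, P i -> 0 <= g i) -> g i0 <= \sum_(i | P i) g i.
Proof.
move=> Pi0 g0; rewrite (bigD1 i0)//= lerDl; apply: sumr_ge0 => i /andP[Pi _].
exact: g0.
Qed.

Section GridStage.
Variables (R : realType) (d k : nat) (W : {set 'I_d}) (s t : grid_vertex d k).
Hypothesis k_gt0 : (0 < k)%N.
Hypothesis st_off : forall c, c \notin W -> s c = t c.
Hypothesis st_on : forall c, c \in W -> (s c == t c) || near_val (s c) (t c).

Local Notation adj := (@grid_adj R d k).
Local Notation D := [set c | s c != t c].

(** [None] labels the cube spanned by [s] and [t] itself, and [Some i] its copy
    with coordinate [i] moved away from [s i]. *)
Definition valid (o : option 'I_d) : bool := if o is Some i then i \notin W else true.

(** The vertex of a copy given by the set [X] of the coordinates in which it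
    moves away from [t]; in the copy [None], the empty set gives [t] and [D]
    gives [s].  Coordinates of [W] on which [s] and [t] agree may move too. *)
Definition copy (o : option 'I_d) (X : {set 'I_d}) : grid_vertex d k :=
  [ffun c => if c \in X then (if s c == t c then other_val (t c) else s c)
             else if o == Some c then other_val (s c) else t c].

Lemma diff_coords_sub : D \subset W.
Proof. by apply/subsetP => c; rewrite inE; apply: contraR => /st_off ->. Qed.

Lemma copy_None_D : copy None D = s.
Proof. by apply/ffunP => c; rewrite ffunE inE; case: eqP => [->|]. Qed.

Lemma copy_None_0 : copy None finset.set0 = t.
Proof. by apply/ffunP => c; rewrite ffunE inE. Qed.

Lemma copy_on o X c : valid o -> c \in W ->
  copy o X c = if c \in X then (if s c == t c then other_val (t c) else s c)
               else t c.
Proof.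
move=> vo cW; rewrite ffunE; case: ifP => // _; case: eqP => // oc.
by rewrite oc /= cW in vo.
Qed.

Lemma copy_off o (X : {set 'I_d}) c : X \subset W -> c \notin W ->
  copy o X c = if o == Some c then other_val (s c) else s c.
Proof.
move=> /subsetP XW cW; rewrite ffunE ifF; last by apply: contraNF cW => /XW.
by rewrite (st_off cW).
Qed.

Lemma copy_near (X : {set 'I_d}) c : c \in W ->
  near_val (if s c == t c then other_val (t c) else s c) (t c).
Proof.
move=> cW; have := st_on cW; case: eqP => // _ _.
by rewrite near_val_sym near_other_val.
Qed.

Lemma copy_inj o (X Y : {set 'I_d}) : valid o -> X \subset W -> Y \subset W ->
  copy o X = copy o Y -> X = Y.
Proof.
move=> vo XW YW /ffunP E; apply/setP => c.
have [cW|cW] := boolP (c \in W); last first.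
  by rewrite (contraNF (subsetP XW c) cW) (contraNF (subsetP YW c) cW).
have := E c; rewrite !copy_on//.
have /near_val_neq/eqP ne := copy_near X cW.
by case: (c \in X); case: (c \in Y) => // /esym.
Qed.

Lemma copy_adj o X Y : valid o -> cube_adj W X Y -> adj (copy o X) (copy o Y).
Proof.
move=> vo /and3P[XW YW /existsP[i /and3P[iW /eqP XY iXY]]].
apply/grid_adjP; exists i.
  rewrite !copy_on//; have := copy_near X iW.
  by case: (i \in X) iXY; case: (i \in Y) => // _; rewrite // near_val_sym.
move=> j ji; rewrite !ffunE; move/setP: XY => /(_ j).
by rewrite !inE ji /= => ->.
Qed.

Lemma copy_adj_None i (X : {set 'I_d}) : i \notin W -> X \subset W ->
  adj (copy None X) (copy (Some i) X).
Proof.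
move=> iW XW; apply/grid_adjP; exists i.
  by rewrite !copy_off// eqxx near_other_val.
by move=> j ji; rewrite !ffunE /= (inj_eq Some_inj) [i == j]eq_sym (negPf ji).
Qed.

(** The copy to which a vertex belongs can be read off its coordinates outside
    [W]; this assigns distinct edges to distinct copies. *)
Definition lab (x : grid_vertex d k) : {set 'I_d} :=
  [set i in ~: W | x i != s i].

Definition lab_of (o : option 'I_d) : {set 'I_d} :=
  if o is Some i then [set i] else finset.set0.

Lemma lab_of_inj : injective lab_of.
Proof.
case=> [i|] [j|] //= /setP E.
- by have := E i; rewrite !inE eqxx => /esym/eqP ->.
- by have := E i; rewrite !inE eqxx.
- by have := E j; rewrite !inE eqxx.
Qed.

Lemma lab_copy o (X : {set 'I_d}) : valid o -> X \subset W -> lab (copy o X) = lab_of o.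
Proof.
move=> vo XW; apply/setP => i; rewrite !inE.
have [iW|iW] /= := boolP (i \in W).
  case: o vo => [j|] /=; last by rewrite inE.
  by rewrite inE; case: eqP => // <-; rewrite iW.
rewrite copy_off//; case: o vo => [j|] /= vj; last by rewrite eqxx inE.
rewrite (inj_eq Some_inj) inE; have [->|ij] := eqVneq i j; last first.
  by rewrite eqxx.
by rewrite eq_sym; apply/near_val_neq/near_other_val.
Qed.

Definition fam (o : option 'I_d) (A : {set grid_vertex d k}) : {set {set 'I_d}} :=
  [set X : {set 'I_d} | (X \subset W) && (copy o X \in A)].

(** The expected-time potential F of a copy, at most 69, becomes a potential
    1 + F / 69 between 1 and 2 whose drift is at least 1 / 138 times itself.
    The value 4 of a copy not yet entered rewards entering it. *)
Definition copy_pot (o : option 'I_d) (A : {set grid_vertex d k}) : R :=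
  if copy o D \in A then 1 + cube_pot R W (fam o A) / 69 else 4.

(** The factor 2 pays for the last step, from the endpoint of a copy back
    to [t]. *)
Definition stage_pot (A : {set grid_vertex d k}) : R :=
  if t \in A then 1 else 2 * \prod_(o | valid o) copy_pot o A.

Lemma started_bounds o (A : {set grid_vertex d k}) :
  1 <= 1 + cube_pot R W (fam o A) / 69 <= 2.
Proof. by have := cube_pot_ge0 R W (fam o A); have := cube_pot_le R W (fam o A); lra. Qed.

Lemma copy_pot_bounds o (A : {set grid_vertex d k}) : 1 <= copy_pot o A <= 4.
Proof. by rewrite /copy_pot; have := started_bounds o A; case: ifP => _; lra. Qed.

Lemma copy_pot_ge0 o (A : {set grid_vertex d k}) : 0 <= copy_pot o A.
Proof. by have := copy_pot_bounds o A; lra. Qed.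

Lemma famS o (A B : {set grid_vertex d k}) : A \subset B -> fam o A \subset fam o B.
Proof. by move=> /subsetP AB; apply/subsetP => X; rewrite !inE => /andP[-> /AB]. Qed.

Lemma copy_pot_anti o : antitone (copy_pot o).
Proof.
move=> A B AB; rewrite /copy_pot.
have := started_bounds o B.
have := cube_pot_anti R W (famS o AB).
by case: ifP => DB; case: ifP => DA; rewrite ?(subsetP AB _ DA)// in DB *; lra.
Qed.

Lemma prod_ge1 (P : pred (option 'I_d)) (A : {set grid_vertex d k}) :
  1 <= \prod_(o | P o) copy_pot o A.
Proof.
elim/big_rec: _ => // o x _ x1.
have [c1 _] := andP (copy_pot_bounds o A).
by apply: mulr_ege1.
Qed.

Lemma prod_anti (P : pred (option 'I_d)) :
  antitone (fun A => \prod_(o | P o) copy_pot o A).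
Proof.
by move=> A B AB; apply: ler_prod => o _; rewrite copy_pot_ge0 copy_pot_anti.
Qed.

Lemma stage_pot_le (A : {set grid_vertex d k}) :
  stage_pot A <= 2 * \prod_(o | valid o) copy_pot o A.
Proof.
rewrite /stage_pot; case: ifP => // _; have := prod_ge1 valid A; lra.
Qed.

Lemma stage_pot_anti : antitone stage_pot.
Proof.
move=> A B AB; rewrite {2}/stage_pot; case: ifP => tA.
  by rewrite /stage_pot (subsetP AB).
apply: le_trans (stage_pot_le _) _; rewrite ler_pM2l//; exact: prod_anti.
Qed.

Lemma stage_pot_bounds (A : {set grid_vertex d k}) : 1 <= stage_pot A <= 2 * 4 ^+ d.+1.
Proof.
apply/andP; split.
  by rewrite /stage_pot; case: ifP => // _; have := prod_ge1 valid A; lra.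
apply: le_trans (stage_pot_le _) _; rewrite ler_pM2l//.
apply: le_trans (_ : \prod_(o | valid o) 4 <= _).
  by apply: ler_prod => o _; rewrite copy_pot_ge0; case/andP: (copy_pot_bounds o A).
rewrite prodr_const ler_eXn2l//; last by rewrite ltr1n.
by rewrite (leq_trans (max_card _))// card_option card_ord.
Qed.

Lemma stage_pot_drop o (A : {set grid_vertex d k}) y : valid o -> t \notin A ->
  2 * \prod_(o' | valid o' && (o' != o)) copy_pot o' A *
    (copy_pot o A - copy_pot o (y |: A)) <=
  stage_pot A - stage_pot (y |: A).
Proof.
move=> vo tA; have := stage_pot_le (y |: A).
rewrite {2}/stage_pot (negPf tA) !(bigD1 o vo)/=.
have := @prod_anti (fun o' => valid o' && (o' != o)) A (y |: A) (subsetUr _ _).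
set P := \prod_(_ | _) _; set P' := \prod_(_ | _) _ => PP'.
have := ler_wpM2l (copy_pot_ge0 o (y |: A)) PP'.
lra.
Qed.

Lemma fam_add o (A : {set grid_vertex d k}) (Y : {set 'I_d}) : valid o -> Y \subset W ->
  fam o (copy o Y |: A) = Y |: fam o A.
Proof.
move=> vo YW; apply/setP => X; rewrite !inE.
have [->|XY] := eqVneq X Y; first by rewrite YW eqxx.
case XW: (X \subset W) => //=; suff /negPf-> : copy o X != copy o Y by [].
by apply: contra_neq XY => /copy_inj ->.
Qed.

(** Each copy always has edges whose drift is a fixed fraction of the potential:
    if the copy has not been entered, the edge from [s] into it; while it is
    being crossed, its cube edges; once it is crossed, the edge to [t]. *)
Lemma copy_drift o (A : {set grid_vertex d k}) : valid o -> s \in A -> t \notin A ->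
  stage_pot A / 138 <=
  \sum_(p : grid_vertex d k * grid_vertex d k |
      [&& p.1 \in A, p.2 \notin A & adj p.1 p.2] &&
      (lab p.1 :|: lab p.2 == lab_of o))
    (stage_pot A - stage_pot (p.2 |: A)).
Proof.
move=> vo sA tA.
have g0 (p : grid_vertex d k * grid_vertex d k) :
    0 <= stage_pot A - stage_pot (p.2 |: A) by exact/antitone_drop/stage_pot_anti.
have labs : lab s = finset.set0 by rewrite -copy_None_D lab_copy// diff_coords_sub.
have labt : lab t = finset.set0 by rewrite -copy_None_0 lab_copy// sub0set.
set Q := \prod_(o' | valid o' && (o' != o)) copy_pot o' A.
have Q1 : 1 <= Q by exact: prod_ge1.
have FQ : stage_pot A = 2 * (copy_pot o A * Q).
  by rewrite /stage_pot (negPf tA) (bigD1 o vo).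
have F2 : 2 <= stage_pot A.
  by rewrite /stage_pot (negPf tA); have := prod_ge1 valid A; lra.
have [inD|inD] := boolP (copy o D \in A); last first.
  case: o vo inD @Q Q1 FQ => [i|] vi inD Q Q1 FQ; last by rewrite copy_None_D sA in inD.
  apply: le_trans (sum_ge_term (i0 := (s, copy (Some i) D)) _ _) => //=.
    apply: le_trans _ (stage_pot_drop _ _ tA); last exact: vi.
    rewrite -/Q FQ /copy_pot (negPf inD) setU11.
    have := started_bounds (Some i) (copy (Some i) D |: A).
    set x := 1 + _ => x2.
    have : Q * 2 <= Q * (4 - x) by rewrite ler_pM2l; lra.
    by lra.
  rewrite sA inD labs set0U lab_copy// ?diff_coords_sub// eqxx andbT /=.
  by rewrite -{1}copy_None_D copy_adj_None ?diff_coords_sub.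
have [in0|in0] := boolP (copy o finset.set0 \in A).
  case: o vo inD in0 @Q Q1 FQ => [i|] vi inD in0 Q Q1 FQ; last first.
    by rewrite copy_None_0 (negPf tA) in in0.
  apply: le_trans (sum_ge_term (i0 := (copy (Some i) finset.set0, t)) _ _) => //=.
    by rewrite {3}/stage_pot setU11; lra.
  rewrite in0 tA labt setU0 lab_copy// ?sub0set// eqxx andbT /=.
  rewrite -[X in adj _ X]copy_None_0; apply/grid_adjP.
  have /grid_adjP[j nj ej] := copy_adj_None vi (sub0set W).
  by exists j; [rewrite near_val_sym|move=> l /ej].
pose E := [set p : {set 'I_d} * {set 'I_d} |
  [&& p.1 \in fam o A, p.2 \notin fam o A & cube_adj W p.1 p.2]].
apply: le_trans (_ : \sum_(p in E)
    (stage_pot A - stage_pot (copy o p.2 |: A)) <= _); last first.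
  apply: (@sum_inj_le _ _ _ _ E (fun p => (copy o p.1, copy o p.2))
    (fun p => stage_pot A - stage_pot (p.2 |: A))) => //.
    move=> [X Y] [X' Y']; rewrite !inE /=.
    move=> /and3P[_ _ /and3P[XW YW _]] /and3P[_ _ /and3P[XW' YW' _]] [].
    by move=> /copy_inj -> // /copy_inj ->.
  move=> [X Y]; rewrite !inE /= => /and3P[/andP[_ XA] YA cXY].
  have [XW YW _] := and3P cXY; rewrite YW in YA.
  by rewrite XA YA copy_adj// !lab_copy// setUid eqxx.
have le2 : copy_pot o A <= 2.
  by rewrite /copy_pot inD; case/andP: (started_bounds o A).
apply: le_trans (_ : 2 * Q / 69 * drift (cube_adj W) (fam o A) (cube_pot R W) <= _).
  have dr : 1 <= drift (cube_adj W) (fam o A) (cube_pot R W).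
    apply: (@cube_pot_drift _ _ _ _ D); rewrite ?diff_coords_sub//.
      by rewrite inE diff_coords_sub inD.
    by rewrite inE (negPf in0) andbF.
  apply: le_trans (_ : 2 * Q / 69 * 1 <= _).
    rewrite FQ; have : copy_pot o A * Q <= 2 * Q by rewrite ler_pM2r//; lra.
    by lra.
  by rewrite ler_pM2l//; lra.
rewrite /drift mulr_sumr (eq_bigl (fun p => p \in E)); last by move=> p; rewrite [RHS]inE.
apply: ler_sum => -[X Y]; rewrite inE /= => /and3P[_ _ /and3P[XW YW _]].
apply: le_trans _ (stage_pot_drop _ vo tA); rewrite -/Q /copy_pot inD.
rewrite inE inD orbT fam_add//; lra.
Qed.

(** Relative drifts of the factors of a product add up, so the number of copies
    becomes the rate.  A bound on exp (theta T) for theta of the order of the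
    dimension is thus obtained from a mere bound on expected times. *)
Lemma grid_stage :
  reach_pot adj (#|~: W|.+1%:R / 138 : R) (2 * 4 ^+ d.+1) s t.
Proof.
exists stage_pot; split; [exact: stage_pot_anti|exact: stage_pot_bounds|].
move=> A sA tA; rewrite /drift.
rewrite (partition_big (fun p => lab p.1 :|: lab p.2) xpredT)//=.
pose V := [set o | valid o].
apply: le_trans (_ : \sum_(o in V) stage_pot A / 138 <= _).
  have F0 : 0 <= stage_pot A by case/andP: (stage_pot_bounds A) => F1 _; lra.
  have LV : (#|~: W|.+1 <= #|V|)%N.
    apply: leq_trans (_ : #|None |: [set Some i | i in ~: W]| <= _)%N.
      rewrite cardsU1 card_imset; last exact: Some_inj.
      by case: imsetP => // -[].
    apply/subset_leq_card/subsetP => o; rewrite !inE => /predU1P[->//|].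
    by case/imsetP => i; rewrite inE => iW ->.
  rewrite sumr_const -[leRHS]mulr_natr.
  have : stage_pot A * #|~: W|.+1%:R <= stage_pot A * #|V|%:R.
    by apply: ler_wpM2l => //; rewrite ler_nat.
  lra.
apply: le_trans (_ : \sum_(o in V) \sum_(p : grid_vertex d k * grid_vertex d k |
      [&& p.1 \in A, p.2 \notin A & adj p.1 p.2] &&
      (lab p.1 :|: lab p.2 == lab_of o))
    (stage_pot A - stage_pot (p.2 |: A)) <= _).
  by apply: ler_sum => o; rewrite inE => vo; apply: copy_drift.
apply: (@sum_inj_le _ _ _ xpredT V lab_of (fun L =>
  \sum_(p : grid_vertex d k * grid_vertex d k |
      [&& p.1 \in A, p.2 \notin A & adj p.1 p.2] &&
      (lab p.1 :|: lab p.2 == L))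
    (stage_pot A - stage_pot (p.2 |: A)))) => //.
  by move=> o o' _ _; exact: lab_of_inj.
by move=> L _; apply: sumr_ge0 => p _; exact/antitone_drop/stage_pot_anti.
Qed.
End GridStage.

(** * Crossing the grid *)

Definition toward (k : nat) (a b : 'I_k.+1) (n : nat) : 'I_k.+1 :=
  inord (if (a <= b)%N then minn (a + n) b else maxn (a - n) b).

Lemma towardE (k : nat) (a b : 'I_k.+1) n :
  toward a b n = (if (a <= b)%N then minn (a + n) b else maxn (a - n) b) :> nat.
Proof.
rewrite inordK//; have := ltn_ord a; have := ltn_ord b.
case: ifP => ab bk ak; first exact: leq_ltn_trans (geq_minr _ _) bk.
by rewrite gtn_max bk andbT (leq_ltn_trans (leq_subr _ _)).
Qed.

Lemma toward_start (k : nat) (a b : 'I_k.+1) : toward a b 0 = a.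
Proof.
apply/val_inj => /=; rewrite towardE; case: (leqP a b) => ab.
  by rewrite addn0; apply/minn_idPl.
by rewrite subn0; apply/maxn_idPl/ltnW.
Qed.

Lemma toward_end (k : nat) (a b : 'I_k.+1) : toward a b k = b.
Proof.
apply/val_inj => /=; rewrite towardE; case: (leqP a b) => ab.
  by apply/minn_idPr; rewrite (leq_trans _ (leq_addl _ _))// -ltnS.
by apply/maxn_idPr; rewrite leq_subLR (leq_trans _ (leq_addr _ _))// -ltnS.
Qed.

Lemma toward_step (k : nat) (a b : 'I_k.+1) n :
  (toward a b n == toward a b n.+1) || near_val (toward a b n) (toward a b n.+1).
Proof.
rewrite /near_val -(inj_eq val_inj) /= !towardE.
move: (nat_of_ord a) (nat_of_ord b) => x y; case: (leqP x y); lia.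
Qed.

(** The coordinates in [H] and the others move in turn, so that the coordinates
    at rest are numerous enough to label parallel copies. *)
Definition waypoint (d k : nat) (H : {set 'I_d}) (s v : grid_vertex d k) (j : nat) :
    grid_vertex d k :=
  [ffun c => toward (s c) (v c) (if c \in H then uphalf j else j./2)].

Lemma exists_half (d : nat) : exists H : {set 'I_d}, #|H| = d./2.
Proof.
exists [set c in take d./2 (enum 'I_d)]; rewrite cardsE.
rewrite (card_uniqP _) ?take_uniq ?enum_uniq// size_take size_enum_ord.
by case: ltnP => //; have := odd_double_half d; lia.
Qed.

Lemma grid_reach_pot (R : realType) (d k : nat) (s v : grid_vertex d k) :
  (0 < k)%N ->
  reach_pot (@grid_adj R d k) (d%:R / 276 : R) ((2 * 4 ^+ d.+1) ^+ (2 * k)) s v.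
Proof.
move=> k0; have [H cardH] := exists_half d.
have start : waypoint H s v 0 = s.
  by apply/ffunP => c; rewrite ffunE if_same toward_start.
have stop : waypoint H s v (2 * k) = v.
  apply/ffunP => c; rewrite ffunE mul2n uphalf_double doubleK if_same.
  exact: toward_end.
rewrite -[X in reach_pot _ _ _ X _]start -[X in reach_pot _ _ _ _ X]stop.
apply: (reach_pot_chain (w := waypoint H s v)) => j _.
pose W := if odd j then ~: H else H.
have W_halves : (d <= 2 * #|~: W|.+1)%N.
  have := cardsC H; rewrite card_ord cardH => cH.
  have := odd_double_half d.
  by rewrite /W; case: ifP => _; rewrite ?setCK ?cardH; lia.
have theta_le : d%:R / 276 <= #|~: W|.+1%:R / 138 :> R.
  rewrite ler_pdivrMr// mulrAC ler_pdivlMr//.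
  have : d%:R <= 2 * #|~: W|.+1%:R :> R by rewrite -natrM ler_nat.
  by lra.
apply: (reach_pot_widen theta_le (lexx _)); apply: grid_stage => // c.
- rewrite /W !ffunE; case: ifP => jo; rewrite ?inE ?negbK => cH.
    by rewrite cH (uphalf_half j.+1) /= jo.
  by rewrite (negPf cH) /= uphalf_half jo.
- rewrite /W !ffunE; case: ifP => jo; rewrite ?inE => cH.
    by rewrite (negPf cH) /= uphalf_half jo toward_step.
  by rewrite cH /= uphalf_half jo toward_step.
Qed.

(** * Expectations along the growth chain *)

(** Boundary edges, oriented from the tree to the new vertex. *)
Definition cut (T : finType) (adj : rel T) (A : {set T}) : {set T * T} :=
  [set p | [&& p.1 \in A, p.2 \notin A & adj p.1 p.2]].

Definition grow (T : finType) (t : subgraph T) (p : T * T) : subgraph T :=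
  (p.2 |: t.1, [set p.1; p.2] |: t.2).

Lemma cut_inj (T : finType) (adj : rel T) (A : {set T}) :
  {in cut adj A &, injective (fun p : T * T => [set p.1; p.2])}.
Proof.
move=> [x y] [x' y']; rewrite !inE /= => /and3P[xA yA _] /and3P[x'A y'A _] E.
have /setP/(_ x) := E; have /setP/(_ y) := E; rewrite !inE !eqxx orbT /=.
have /negPf-> : y != x' by apply: contraNneq yA => ->.
have /negPf-> : x != y' by apply: contraNneq y'A => <-.
by rewrite orbF => /esym/eqP -> /esym/eqP ->.
Qed.

Lemma boundaryE (T : finType) (adj : rel T) (t : subgraph T) :
  symmetric adj -> irreflexive adj ->
  boundary adj t = [set [set p.1; p.2] | p in cut adj t.1].
Proof.
move=> sym irr; apply/setP => b; rewrite inE; apply/andP/imsetP; last first.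
  case=> -[x y]; rewrite inE /= => /and3P[xA yA xy] ->; split.
    by apply/imsetP; exists (x, y); rewrite ?inE.
  apply/cards1P; exists x; apply/setP => z; rewrite !inE.
  have [->|_] := eqVneq z x; first by rewrite xA.
  by have [->|//] := eqVneq z y; rewrite (negPf yA).
case=> /imsetP[[x y]]; rewrite inE /= => xy ->.
have [xA|xA] := boolP (x \in t.1); have [yA|yA] := boolP (y \in t.1).
- rewrite (setIidPl _) ?subUset ?sub1set ?xA// cards2.
  by have [exy|//] := eqVneq x y; rewrite exy irr in xy.
- by exists (x, y); rewrite // inE xA yA.
- by exists (y, x) => /=; [rewrite inE /= xA yA sym|rewrite setUC].
- rewrite (_ : _ :&: _ = finset.set0) ?cards0//; apply/setP => z; rewrite !inE.
  have [->|_] := eqVneq z x; first by rewrite (negPf xA).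
  by have [->|//] := eqVneq z y; rewrite (negPf yA).
Qed.

Lemma add_edge_cut (T : finType) (adj : rel T) (t : subgraph T) p :
  p \in cut adj t.1 -> add_edge t [set p.1; p.2] = grow t p.
Proof.
rewrite inE => /and3P[xA _ _]; congr pair; apply/setP => z; rewrite !inE.
by have [->|] := eqVneq z p.1; rewrite ?xA ?orbT//= orbC.
Qed.

Lemma sum_boundary (R : realType) (T : finType) (adj : rel T) (t : subgraph T)
    (g : subgraph T -> R) :
  symmetric adj -> irreflexive adj ->
  \sum_(b in boundary adj t) g (add_edge t b) =
  \sum_(p in cut adj t.1) g (grow t p).
Proof.
move=> sym irr; rewrite boundaryE// big_imset; last exact: cut_inj.
by apply: eq_bigr => p pc /=; rewrite (add_edge_cut pc).
Qed.

Lemma card_boundary (T : finType) (adj : rel T) (t : subgraph T) :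
  symmetric adj -> irreflexive adj -> #|boundary adj t| = #|cut adj t.1|.
Proof. by move=> sym irr; rewrite boundaryE// card_in_imset//; exact: cut_inj. Qed.

Definition expect (R : realType) (T : finType) (adj : rel T) (s : T) (i : nat)
    (g : subgraph T -> R) : R :=
  \sum_(t : subgraph T) growth_law R adj s i t * g t.

Lemma expect0 (R : realType) (T : finType) (adj : rel T) (s : T)
    (g : subgraph T -> R) :
  expect adj s 0 g = g ([set s], finset.set0).
Proof.
rewrite /expect (bigD1 ([set s], finset.set0))//= eqxx mul1r big1 ?addr0//.
by move=> t /negPf tN; rewrite tN mul0r.
Qed.

Lemma expectS (R : realType) (T : finType) (adj : rel T) (s : T) i
    (g : subgraph T -> R) :
  symmetric adj -> irreflexive adj ->
  expect adj s i.+1 g =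
  expect adj s i (fun u =>
    (\sum_(p in cut adj u.1) g (grow u p)) / #|cut adj u.1|%:R).
Proof.
move=> sym irr; rewrite /expect /=.
have distr (h : subgraph T -> R) c :
    (\sum_t h t) * c = \sum_t h t * c by rewrite mulr_suml.
transitivity (\sum_u \sum_t growth_law R adj s i u *
    ((\sum_(b in boundary adj u) (add_edge u b == t)%:R / #|boundary adj u|%:R)
     * g t)).
  rewrite exchange_big /=; apply: eq_bigr => t _; rewrite distr.
  by apply: eq_bigr => u _; rewrite mulrA.
apply: eq_bigr => u _; rewrite -mulr_sumr; congr (_ * _).
rewrite -sum_boundary// -card_boundary// mulr_suml.
transitivity (\sum_(b in boundary adj u) \sum_t
    (add_edge u b == t)%:R / #|boundary adj u|%:R * g t).
  by rewrite exchange_big /=; apply: eq_bigr => t _; rewrite mulr_suml.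
apply: eq_bigr => b _; rewrite (bigD1 (add_edge u b))//= eqxx big1 ?addr0 => [|t].
  by rewrite div1r mulrC.
by rewrite eq_sym => /negPf ->; rewrite !mul0r.
Qed.

Lemma growth_law_ge0 (R : realType) (T : finType) (adj : rel T) (s : T) i t :
  0 <= growth_law R adj s i t.
Proof.
elim: i t => [|i IHi] t /=; first exact: ler0n.
apply: sumr_ge0 => u _; rewrite mulr_ge0//; apply: sumr_ge0 => b _.
by rewrite divr_ge0.
Qed.

(** Invariants of the growth hold on the support of the law. *)
Lemma growth_law_ind (R : realType) (T : finType) (adj : rel T) (s : T)
    (P : nat -> subgraph T -> Prop) :
  symmetric adj -> irreflexive adj ->
  P 0%N ([set s], finset.set0) ->
  (forall i u p, P i u -> p \in cut adj u.1 -> P i.+1 (grow u p)) ->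
  forall i t, growth_law R adj s i t != 0 -> P i t.
Proof.
move=> sym irr P0 PS; elim=> [|i IHi] t /=.
  by have [->//|_] := eqVneq t ([set s], finset.set0); rewrite eqxx.
move=> law_t; have [u] : exists u, growth_law R adj s i u *
    \sum_(b in boundary adj u) (add_edge u b == t)%:R / #|boundary adj u|%:R
      != 0 :> R.
  apply/existsP; rewrite -negb_forall; apply: contra law_t => /forallP all0.
  by apply/eqP; apply: big1 => u _; apply/eqP/all0.
rewrite mulf_eq0 negb_or => /andP[/IHi Pu].
have [/existsP[b /andP[bb /eqP <-]] _|no_b] :=
    boolP [exists b in boundary adj u, add_edge u b == t].
  move: bb; rewrite boundaryE// => /imsetP[p pc ->].
  by rewrite (add_edge_cut pc); apply: PS.
case/eqP; apply: big1 => b bb; move: no_b; rewrite negb_exists => /forallP/(_ b).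
by rewrite bb /= => /negPf ->; rewrite mul0r.
Qed.

(** Supermartingales have decreasing expectations.  Mass is lost if the boundary
    is empty, which is harmless since [g] is nonnegative. *)
Lemma expect_le (R : realType) (T : finType) (adj : rel T) (s : T)
    (P : nat -> subgraph T -> Prop) (g : subgraph T -> R) :
  symmetric adj -> irreflexive adj ->
  P 0%N ([set s], finset.set0) ->
  (forall i u p, P i u -> p \in cut adj u.1 -> P i.+1 (grow u p)) ->
  (forall u, 0 <= g u) ->
  (forall i u, P i u ->
    \sum_(p in cut adj u.1) g (grow u p) <= #|cut adj u.1|%:R * g u) ->
  forall i, expect adj s i g <= g ([set s], finset.set0).
Proof.
move=> sym irr P0 PS g0 gdrift; elim=> [|i IHi]; first by rewrite expect0.
rewrite expectS//; apply: le_trans IHi; apply: ler_sum => u _.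
have [->|law_u] := eqVneq (growth_law R adj s i u) 0; first by rewrite !mul0r.
rewrite ler_wpM2l ?growth_law_ge0//.
have [c0|c0] := posnP #|cut adj u.1|; first by rewrite c0 invr0 mulr0.
rewrite ler_pdivrMr ?ltr0n// mulrC (gdrift i)//.
by apply: (growth_law_ind (R := R) sym irr P0 PS) law_u.
Qed.

Lemma growth_law_mass (R : realType) (T : finType) (adj : rel T) (s : T)
    (P : nat -> subgraph T -> Prop) (n : nat) :
  symmetric adj -> irreflexive adj ->
  P 0%N ([set s], finset.set0) ->
  (forall i u p, P i u -> p \in cut adj u.1 -> P i.+1 (grow u p)) ->
  (forall i u, P i u -> (i < n)%N -> (0 < #|cut adj u.1|)%N) ->
  forall i, (i <= n)%N -> \sum_t growth_law R adj s i t = 1.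
Proof.
move=> sym irr P0 PS nonempty i i_n.
suff <- : expect adj s i (fun=> 1) = 1 :> R.
  by rewrite /expect; apply: eq_bigr => t _; rewrite mulr1.
elim: i i_n => [|i IHi] i_n; first by rewrite expect0.
rewrite expectS// -[RHS](IHi (ltnW i_n)); apply: eq_bigr => u _.
have [->|law_u] := eqVneq (growth_law R adj s i u) 0; first by rewrite !mul0r.
rewrite sumr_const divff// pnatr_eq0 -lt0n; apply: nonempty i_n.
by apply: (growth_law_ind (R := R) sym irr P0 PS) law_u.
Qed.

(** * Paths from the root *)

Definition root_path (T : finType) (s : T) (t : subgraph T) (p : seq T) : bool :=
  path (tree_adj t) s p && uniq (s :: p).

Definition rooted (T : finType) (s : T) (t : subgraph T) : Prop :=
  s \in t.1 /\ forall b, b \in t.2 -> b \subset t.1.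

Lemma tree_adj_sym (T : finType) (t : subgraph T) : symmetric (tree_adj t).
Proof. by move=> x y; rewrite /tree_adj setUC. Qed.

Lemma rooted_adj (T : finType) (s : T) (t : subgraph T) x y :
  rooted s t -> tree_adj t x y -> x \in t.1 /\ y \in t.1.
Proof. by move=> [_ sub] /sub; rewrite subUset !sub1set => /andP. Qed.

Lemma root_path_rcons (T : finType) (s : T) (t : subgraph T) p x :
  root_path s t (rcons p x) =
  [&& root_path s t p, tree_adj t (last s p) x & x \notin s :: p].
Proof.
rewrite /root_path rcons_path -rcons_cons rcons_uniq.
by case: (path _ _ _); case: (tree_adj _ _ _); rewrite ?andbF //= andbC.
Qed.

Lemma root_path_in (T : finType) (s : T) (t : subgraph T) p :
  rooted s t -> root_path s t p -> {subset s :: p <= t.1}.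
Proof.
move=> rt; elim/last_ind: p => [_|p x IHp].
  by move=> y; rewrite inE => /eqP ->; case: rt.
rewrite root_path_rcons => /and3P[/IHp sub adj_x _] y.
rewrite -rcons_cons mem_rcons inE => /predU1P[->|/sub//].
by have [] := rooted_adj rt adj_x.
Qed.

Lemma root_path_last (T : finType) (s : T) (t : subgraph T) p :
  rooted s t -> root_path s t p -> last s p \in t.1.
Proof. by move=> rt /(root_path_in rt) sub; apply/sub/mem_last. Qed.

Lemma root_path_grow (T : finType) (s : T) (t : subgraph T) e p :
  root_path s t p -> root_path s (grow t e) p.
Proof.
case/andP=> pt up; apply/andP; split=> //; apply: sub_path pt => x y.
by rewrite /tree_adj inE => ->; rewrite orbT.
Qed.

Lemma grow_adj (T : finType) (s : T) (t : subgraph T) x y z w :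
  rooted s t -> x \in t.1 -> y \notin t.1 -> z \in t.1 ->
  tree_adj (grow t (x, y)) z w = tree_adj t z w || ((z == x) && (w == y)).
Proof.
move=> rt xt yt zt; rewrite /tree_adj inE orbC /=; congr (_ || _).
have zy : z != y by apply: contraNneq yt => <-.
rewrite inE.
apply/eqP/andP => [E|[/eqP -> /eqP ->]//].
have /setP/(_ z) := E; have /setP/(_ y) := E.
rewrite !inE !eqxx orbT orTb (negPf zy) orbF eq_sym (negPf zy) /= => /eqP <-.
by move=> /esym ->.
Qed.

(** The new vertex [y] has a single neighbour in the new tree, so a path that
    visits [y] ends there. *)
Lemma root_path_growP (T : finType) (s : T) (t : subgraph T) x y p :
  rooted s t -> x \in t.1 -> y \notin t.1 ->
  root_path s (grow t (x, y)) p ->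
  root_path s t p \/
  exists2 q, p = rcons q y & root_path s t q && (last s q == x).
Proof.
move=> rt xt yt; elim/last_ind: p => [|p z IHp].
  by move=> _; left.
rewrite root_path_rcons => /and3P[/IHp pp adj_z zp].
case: pp => [pt|[q eq_p /andP[qt /eqP qx]]].
  have lt_ := root_path_last rt pt.
  rewrite (grow_adj _ rt xt yt lt_) in adj_z.
  case/orP: adj_z => [adj_z|/andP[lx /eqP ->]].
    by left; rewrite root_path_rcons pt adj_z.
  by right; exists p; rewrite // pt.
rewrite eq_p last_rcons tree_adj_sym in adj_z.
have [zt|zt] := boolP (z \in t.1).
  rewrite (grow_adj _ rt xt yt zt) in adj_z.
  case/orP: adj_z => [adj_z|/andP[/eqP zx _]].
    by have [_] := rooted_adj rt adj_z; rewrite (negPf yt).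
  by move: zp; rewrite zx eq_p -rcons_cons mem_rcons inE -qx mem_last orbT.
move: adj_z; rewrite /tree_adj !inE => /orP[/eqP E|]; last first.
  by case: rt => _ sub /sub; rewrite subUset !sub1set (negPf zt).
have /setP/(_ x) := E; have xz : x != z by apply: contraNneq zt => <-.
have xy : x != y by apply: contraNneq yt => <-.
by rewrite !inE eqxx (negPf xz) (negPf xy).
Qed.

Lemma root_path_grow_rcons (T : finType) (s : T) (t : subgraph T) x y p :
  rooted s t -> x \in t.1 -> y \notin t.1 ->
  root_path s t p -> last s p = x -> root_path s (grow t (x, y)) (rcons p y).
Proof.
move=> rt xt yt pt px; rewrite root_path_rcons root_path_grow//= px.
rewrite (grow_adj _ rt xt yt xt) !eqxx orbT /=.
by apply: contra yt; apply: root_path_in.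
Qed.

(** The last clause replaces acyclicity: it is all that is needed to find
    leaves, and it is inherited by the next tree since the new vertex is a leaf
    and only its neighbour may cease to be one. *)
Definition growing (T : finType) (s : T) (i : nat) (t : subgraph T) : Prop :=
  [/\ rooted s t, #|t.1| = i.+1,
      forall v, v \in t.1 -> exists2 p, root_path s t p & last s p = v &
      forall p, root_path s t p -> exists q, root_leaf_path s t (p ++ q)].

Lemma growing0 (T : finType) (s : T) : growing s 0 ([set s], finset.set0).
Proof.
have no_adj x y : tree_adj ([set s], finset.set0) x y = false by rewrite /tree_adj inE.
split; rewrite ?cards1//.
- by split=> [|b]; rewrite inE.
- by move=> v; rewrite inE => /eqP ->; exists [::].
- case=> [|x p]; last by rewrite /root_path /= no_adj.
  move=> _; exists [::]; rewrite /root_leaf_path /leaf /= inE eqxx /=.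
  rewrite /tree_degree (_ : [set _ | _] = finset.set0) ?cards0//.
  by apply/setP => y; rewrite !inE no_adj.
Qed.

Lemma growingS (T : finType) (adj : rel T) (s : T) i (t : subgraph T) e :
  growing s i t -> e \in cut adj t.1 -> growing s i.+1 (grow t e).
Proof.
case: e => x y [rt card_t reach ext]; rewrite inE => /and3P[/= xt yt _].
have [st sub] := rt.
have rt' : rooted s (grow t (x, y)).
  split=> [|b]; first by rewrite inE st orbT.
  move=> /setU1P[->|/sub /subset_trans->//]; last exact: subsetUr.
  by apply/subsetP => z; rewrite !inE => /orP[/eqP ->|->]//; rewrite xt orbT.
have [px pxt px_x] := reach x xt.
have new_path p : root_path s t p -> last s p = x ->
    root_leaf_path s (grow t (x, y)) (rcons p y).
  move=> pt p_x.
  rewrite /root_leaf_path; have /andP[-> ->] /= := root_path_grow_rcons rt xt yt pt p_x.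
  rewrite last_rcons /leaf setU11 /= (_ : y != s); last by apply: contraNneq yt => ->.
  rewrite /tree_degree (_ : [set _ | _] = [set x]) ?cards1//.
  apply/setP => z; rewrite !inE tree_adj_sym.
  have [zt|zt] := boolP (z \in t.1).
    rewrite (grow_adj _ rt xt yt zt) eqxx andbT; case: (boolP (tree_adj t z y)) => //.
    by move=> /(rooted_adj rt)[_]; rewrite (negPf yt).
  rewrite (_ : z == x = false); last by apply: contraNF zt => /eqP ->.
  apply/negbTE; rewrite /tree_adj !inE negb_or; apply/andP; split.
    apply/eqP => /setP/(_ x); rewrite !inE eqxx.
    have /negPf-> : x != z by apply: contraNneq zt => <-.
    by have /negPf-> : x != y by apply: contraNneq yt => <-.
  by apply: contra zt => /(rooted_adj rt)[].
split=> //.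
- by rewrite cardsU1 yt card_t.
- move=> v /setU1P[->|vt].
    by exists (rcons px y); rewrite ?last_rcons// root_path_grow_rcons.
  by have [p pt pv] := reach v vt; exists p => //; exact: root_path_grow.
- move=> p /(root_path_growP rt xt yt)[pt|[q -> /andP[qt /eqP qx]]]; last first.
    by exists [::]; rewrite cats0 new_path.
  have [q /and3P[pqt pqu leaf_pq]] := ext p pt.
  have rpq : root_path s t (p ++ q) by rewrite /root_path pqt.
  have [ex|nx] := eqVneq (last s (p ++ q)) x.
    by exists (rcons q y); rewrite -rcons_cat new_path.
  exists q; rewrite /root_leaf_path pqu.
  have /andP[-> _] /= := root_path_grow (x, y) rpq.
  move: leaf_pq; rewrite /leaf => /andP[lt_ /eqP <-]; rewrite inE lt_ orbT /=.
  apply/eqP/eq_card => z; rewrite !inE (grow_adj _ rt xt yt lt_).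
  by rewrite (negPf nx) orbF.
Qed.

(** * Path sums and their growth *)

(** Bounded sequences form a finite type, and they include every path without
    repetition. *)
Definition path_sum (R : realType) (T : finType) (s : T) (t : subgraph T) : R :=
  \sum_(p : #|T|.-bseq T | root_path s t p) 2 ^+ size p.

Definition path_sum_at (R : realType) (T : finType) (s : T) (t : subgraph T)
    (v : T) : R :=
  \sum_(p : #|T|.-bseq T | root_path s t p && (last s p == v)) 2 ^+ size p.

Lemma path_sum_split (R : realType) (T : finType) (s : T) (t : subgraph T) :
  path_sum R s t = \sum_v path_sum_at R s t v.
Proof. by rewrite /path_sum (partition_big (fun p : #|T|.-bseq T => last s p) xpredT). Qed.

Lemma path_sum_at_ge0 (R : realType) (T : finType) (s : T) (t : subgraph T) v :
  0 <= path_sum_at R s t v.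
Proof. by apply: sumr_ge0 => p _; apply: exprn_ge0. Qed.

Lemma path_sum_at_le (R : realType) (T : finType) (s : T) (t : subgraph T) v :
  path_sum_at R s t v <= path_sum R s t.
Proof.
rewrite path_sum_split; apply: (@sum_ge_term _ _ xpredT) => // u _.
exact: path_sum_at_ge0.
Qed.

Lemma path_sum_ge1 (R : realType) (T : finType) (s : T) (t : subgraph T) :
  1 <= path_sum R s t.
Proof.
by apply: (@sum_ge_term _ _ _ (fun p : #|T|.-bseq T => 2 ^+ size p) [bseq]).
Qed.

Lemma path_sum0 (R : realType) (T : finType) (s : T) :
  path_sum R s ([set s], finset.set0) = 1.
Proof.
rewrite /path_sum (bigD1 [bseq])//= expr0 big1 ?addr0// => p /andP[+ p0].
case: p p0 => -[//|x p] szp p0; rewrite /root_path /= /tree_adj inE.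
by [].
Qed.

Lemma path_sum_at_ge (R : realType) (T : finType) (s : T) (t : subgraph T)
    (p : seq T) :
  root_path s t p -> 2 ^+ size p <= path_sum_at R s t (last s p).
Proof.
move=> pt; have szp : (size p <= #|T|)%N.
  by case/andP: pt => _ /uniq_leq_size/(_ (fun x _ => mem_enum T x))/ltnW; rewrite -cardE.
rewrite -[p]/(val (Bseq szp)).
apply: (@sum_ge_term _ _ _ (fun p : #|T|.-bseq T => 2 ^+ size p) (Bseq szp)).
  by rewrite /= pt eqxx.
by move=> q _; apply: exprn_ge0.
Qed.

Lemma path_sum_at_grow (R : realType) (T : finType) (adj : rel T) (s : T)
    (t : subgraph T) e v :
  rooted s t -> e \in cut adj t.1 -> v \in t.1 ->
  path_sum_at R s (grow t e) v <= path_sum_at R s t v.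
Proof.
case: e => x y rt; rewrite inE => /and3P[/= xt yt _] vt.
rewrite /path_sum_at big_mkcond [leRHS]big_mkcond; apply: ler_sum => p _.
case: ifP => [/andP[/(root_path_growP rt xt yt)[->|[q -> _]] /eqP last_p]|_].
- by rewrite last_p eqxx.
- by move: last_p vt yt; rewrite last_rcons => -> ->.
- by case: ifP => // _; apply: exprn_ge0.
Qed.

(** Removing the last vertex maps the new paths injectively to the old paths
    that end at the attachment point, and halves their weight. *)
Lemma path_sum_grow (R : realType) (T : finType) (adj : rel T) (s : T)
    (t : subgraph T) e :
  rooted s t -> e \in cut adj t.1 ->
  path_sum R s (grow t e) <= path_sum R s t + 2 * path_sum_at R s t e.1.
Proof.
case: e => x y rt; rewrite inE => /and3P[/= xt yt _].
rewrite /path_sum (bigID (fun p : #|T|.-bseq T => root_path s t p)) /=.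
pose N := [set p : #|T|.-bseq T | root_path s (grow t (x, y)) p && ~~ root_path s t p].
have newP p : p \in N -> exists2 q, p = rcons q y :> seq T &
    root_path s t q && (last s q == x).
  by rewrite inE => /andP[/(root_path_growP rt xt yt)[->|]].
apply: lerD.
  rewrite le_eqVlt; apply/orP; left; apply/eqP; apply: eq_bigl => p.
  by case pt: (root_path s t p); rewrite ?andbF// root_path_grow.
rewrite (eq_bigl [in N]); last by move=> p; rewrite [RHS]inE.
rewrite /path_sum_at mulr_sumr.
have cutoff p : p \in N -> 2 ^+ size p = 2 * 2 ^+ (size p).-1 :> R.
  by case/newP => q -> _; rewrite size_rcons exprS.
pose trim (p : #|T|.-bseq T) : #|T|.-bseq T := [bseq of take (size p).-1 p].
have trimE (p : #|T|.-bseq T) q : p = rcons q y :> seq T -> trim p = q :> seq T.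
  by move=> pq; rewrite /= pq size_rcons /= -cats1 take_size_cat.
apply: le_trans (_ : \sum_(p in N) 2 * 2 ^+ size (trim p) <= _).
  apply: ler_sum => p pN; rewrite cutoff//.
  by have [q pq _] := newP p pN; rewrite (trimE _ _ pq) pq size_rcons.
apply: (@sum_inj_le _ _ _ _ N trim (fun p => 2 * 2 ^+ size (p : seq T))).
- move=> p p' /newP[q pq _] /newP[q' pq' _] trim_eq.
  apply/val_inj; rewrite /= pq pq'.
  by rewrite -(trimE _ _ pq) -(trimE _ _ pq') trim_eq.
- by move=> p /newP[q pq]; rewrite -(trimE _ _ pq).
- by move=> p _; rewrite mulr_ge0// exprn_ge0.
Qed.

(** The relative growth rate of the path sum is at most 2 [D]: each path ending
    at x gives birth to paths of twice its weight, at a rate that is at most the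
    degree of x. *)
Lemma path_sum_drift (R : realType) (T : finType) (adj : rel T) (s : T)
    (t : subgraph T) (D : nat) :
  (forall x, (#|[set y | adj x y]| <= D)%N) -> rooted s t ->
  \sum_(p in cut adj t.1) path_sum R s (grow t p) <=
  (#|cut adj t.1|%:R + 2 * D%:R) * path_sum R s t.
Proof.
move=> deg rt.
apply: le_trans (_ : \sum_(p in cut adj t.1)
    (path_sum R s t + 2 * path_sum_at R s t p.1) <= _).
  by apply: ler_sum => p pc; apply: path_sum_grow rt pc.
rewrite big_split /= sumr_const mulrDl -(mulr_natl (path_sum R s t)).
rewrite lerD2l -mulr_sumr -mulrA ler_pM2l//.
apply: le_trans (_ : \sum_x \sum_(y in [set y | adj x y]) path_sum_at R s t x <= _).
  rewrite [leRHS]pair_big_dep /=.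
  apply: (@sum_inj_le _ _ _ _ (cut adj t.1) id (fun p => path_sum_at R s t p.1)) => //.
    by move=> [x y]; rewrite !inE => /and3P[].
  by move=> p _; apply: path_sum_at_ge0.
rewrite path_sum_split mulr_sumr; apply: ler_sum => x _.
rewrite sumr_const -[leLHS]mulr_natl; apply: ler_wpM2r; first exact: path_sum_at_ge0.
by rewrite ler_nat.
Qed.

(** The concave function x^al y^(1-al) lies below its tangent at (a, b). *)
Lemma weighted_AMGM (R : realType) (al a b x y : R) :
  0 < al < 1 -> 0 < a -> 0 < b -> 0 <= x -> 0 <= y ->
  x `^ al * y `^ (1 - al) <=
  a `^ al * b `^ (1 - al) * (al * (x / a) + (1 - al) * (y / b)).
Proof.
move=> /andP[al0 al1] a0 b0 x0 y0.
have be0 : 0 < 1 - al by rewrite subr_gt0.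
have := @conjugate_powR R ((x / a) `^ al) ((y / b) `^ (1 - al)) al^-1 (1 - al)^-1
  (powR_ge0 _ _) (powR_ge0 _ _).
rewrite !invr_gt0 !invrK => /(_ al0 be0); rewrite addrC subrK => /(_ erefl).
rewrite -!powRrM !mulfV ?gt_eqF// !powRr1 ?divr_ge0// ?(ltW a0) ?(ltW b0)// => amgm.
have xE : x `^ al = a `^ al * (x / a) `^ al.
  by rewrite -powRM ?divr_ge0 ?(ltW a0)// mulrC divfK ?gt_eqF.
have yE : y `^ (1 - al) = b `^ (1 - al) * (y / b) `^ (1 - al).
  by rewrite -powRM ?divr_ge0 ?(ltW b0)// mulrC divfK ?gt_eqF.
rewrite xE yE mulrACA; apply: ler_wpM2l; first by rewrite mulr_ge0 ?powR_ge0.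
by rewrite mulrC (mulrC al) (mulrC (1 - al)) mulrC.
Qed.

(** * Tail of the height *)

(** Let F be the potential for reaching [v].  Until [v] is reached, the relative
    growth rate of path_sum^al * F^(1-al) is at most
    al * (2 * D) - (1 - al) * theta, hence nonpositive.  When [v] is reached, F
    is at least 1, so that the product dominates the sum over the paths ending
    at [v] to the power al, and later trees contain no new path to [v]. *)
Lemma endpoint_tail (R : realType) (T : finType) (adj : rel T) (s v : T) (D : nat)
    (theta B al X : R) i :
  symmetric adj -> irreflexive adj ->
  (forall x, (#|[set y | adj x y]| <= D)%N) ->
  reach_pot adj theta B s v ->
  0 < al < 1 -> al * (2 * D%:R) <= (1 - al) * theta ->
  2 `^ (al * X) * (\sum_(t | [exists p : #|T|.-bseq T,
      [&& root_path s t p, last s p == v & X < (size p)%:R]])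
      growth_law R adj s i t) <= B.
Proof.
move=> sym irr deg [F [_ bndF driftF]] al01 al_le.
have [al0 al1] := andP al01.
have F1 A : 1 <= F A by case/andP: (bndF A).
have F0 A : 0 < F A by apply: lt_le_trans (F1 A).
pose J (t : subgraph T) := if v \in t.1 then path_sum_at R s t v `^ al
  else path_sum R s t `^ al * F t.1 `^ (1 - al).
have sum0 t : 0 < path_sum R s t by apply: lt_le_trans (path_sum_ge1 _ _ _).
have J0 t : 0 <= J t.
  by rewrite /J; case: ifP => _; rewrite ?mulr_ge0 ?powR_ge0.
have powF A : 1 <= F A `^ (1 - al).
  suff : 1 `^ (1 - al) <= F A `^ (1 - al) by rewrite powR1.
  by apply: ge0_ler_powR; rewrite ?nnegrE ?subr_ge0 ?(ltW al1) ?(ltW (F0 _)) //.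
have J_le t : J t <= path_sum R s t `^ al * F t.1 `^ (1 - al).
  rewrite /J; case: ifP => // _; apply: le_trans (_ : path_sum R s t `^ al <= _).
    apply: ge0_ler_powR; rewrite ?nnegrE ?path_sum_at_ge0 ?path_sum_at_le//.
    - exact: ltW.
    - exact: ltW.
  by rewrite ler_peMr ?powR_ge0.
have J_drift j u : growing s j u ->
    \sum_(p in cut adj u.1) J (grow u p) <= #|cut adj u.1|%:R * J u.
  case=> rt card_u reach _; have [vu|vu] := boolP (v \in u.1).
    rewrite mulr_natl -sumr_const; apply: ler_sum => p pc.
    rewrite /J vu inE vu orbT.
    apply: ge0_ler_powR; rewrite ?nnegrE ?path_sum_at_ge0 ?(ltW al0)//.
    exact: path_sum_at_grow rt pc vu.
  set a := path_sum R s u; set b := F u.1; set c := #|cut adj u.1|%:R.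
  have -> : J u = a `^ al * b `^ (1 - al) by rewrite /J (negPf vu).
  set M := a `^ al * b `^ (1 - al).
  have M0 : 0 <= M by rewrite mulr_ge0 ?powR_ge0.
  have a0 : 0 < a by exact: sum0.
  have b0 : 0 < b by exact: F0.
  apply: le_trans (_ : \sum_(p in cut adj u.1)
      M * (al * (path_sum R s (grow u p) / a) +
           (1 - al) * (F (p.2 |: u.1) / b)) <= _).
    apply: ler_sum => p _; apply: le_trans (J_le _) _.
    by apply: weighted_AMGM => //; rewrite ltW.
  rewrite -mulr_sumr big_split /= -!mulr_sumr -!mulr_suml [leRHS]mulrC.
  apply: ler_wpM2l => //.
  have sum_paths : (\sum_(p in cut adj u.1) path_sum R s (grow u p)) / a <=
      c + 2 * D%:R.
    by rewrite ler_pdivrMr//; exact: path_sum_drift.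
  have sum_F : (\sum_(p in cut adj u.1) F (p.2 |: u.1)) / b <= c - theta.
    rewrite ler_pdivrMr// mulrBl lerBrDr -lerBrDl.
    have -> : c * b = \sum_(p in cut adj u.1) b by rewrite sumr_const mulr_natl.
    rewrite -sumrB; apply: le_trans (driftF _ _ vu) _; first by case: rt.
    by rewrite /drift (eq_bigl [in cut adj u.1])// => p; rewrite [RHS]inE.
  have h1 := ler_wpM2l (ltW al0) sum_paths.
  have be0 : 0 <= 1 - al by rewrite subr_ge0 ltW.
  have h2 := ler_wpM2l be0 sum_F.
  by lra.
have step j u p : growing s j u -> p \in cut adj u.1 -> growing s j.+1 (grow u p).
  exact: growingS.
have J_start : J ([set s], finset.set0) <= B.
  apply: le_trans (J_le _) _; rewrite path_sum0 powR1 mul1r.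
  apply: le_trans (_ : F [set s] <= _); last by case/andP: (bndF [set s]).
  rewrite -[leRHS]powRr1 ?(ltW (F0 _))//; apply: ler_powR => //; lra.
apply: le_trans J_start.
apply: le_trans (expect_le sym irr (growing0 s) step J0 J_drift i).
rewrite mulr_sumr big_mkcond; apply: ler_sum => t _.
have law0 := growth_law_ge0 R adj s i t.
case: ifP => [/existsP[p /and3P[pt /eqP pv Xp]]|_]; last by rewrite mulr_ge0.
have [->|law_t] := eqVneq (growth_law R adj s i t) 0; first by rewrite mulr0 mul0r.
have [rt _ _ _] := growth_law_ind (R := R) sym irr (growing0 s) step law_t.
rewrite mulrC ler_wpM2l// /J -pv root_path_last//.
rewrite mulrC powRrM.
apply: ge0_ler_powR; rewrite ?nnegrE ?powR_ge0 ?path_sum_at_ge0 ?(ltW al0)//.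
apply: le_trans (path_sum_at_ge _ pt).
by rewrite -powR_mulrn//; apply: ler_powR; rewrite ?ler1n// ltW.
Qed.

Lemma size_root_path (T : finType) (s : T) (t : subgraph T) p :
  root_path s t p -> (size p < #|T|)%N.
Proof.
case/andP=> _ up; rewrite -[X in (X < _)%N]/(size (s :: p)).-1 /=.
by rewrite -[(size p).+1]/(size (s :: p)) -(card_uniqP up) max_card.
Qed.

Lemma height_ge (T : finType) (s : T) (t : subgraph T) p :
  root_leaf_path s t p -> (size p <= height s t)%N.
Proof.
move=> leaf_p; have pt : root_path s t p by case/and3P: leaf_p => h1 h2 _; apply/andP.
apply: (@leq_bigmax_cond _ _ (fun l : 'I_#|T| => l : nat)
  (Ordinal (size_root_path pt))).
by apply/existsP; exists (in_tuple p).
Qed.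

Lemma height_attained (T : finType) (s : T) (t : subgraph T) :
  (0 < height s t)%N -> exists2 p, root_path s t p & size p = height s t.
Proof.
rewrite /height; pose Q (l : 'I_#|T|) := [exists p : l.-tuple T, root_leaf_path s t p].
case: (pickP Q) => [l0 Ql0 _|no_l]; last by rewrite big_pred0.
have [|l Ql ->] := @eq_bigmax_cond _ Q (fun l => l : nat).
  by apply/card_gt0P; exists l0.
have /existsP[p /and3P[h1 h2 _]] := Ql.
by exists p; rewrite ?size_tuple// /root_path h1.
Qed.

Lemma height_tail (R : realType) (T : finType) (adj : rel T) (s : T) (D : nat)
    (theta B al X : R) i :
  symmetric adj -> irreflexive adj ->
  (forall x, (#|[set y | adj x y]| <= D)%N) ->
  (forall v, reach_pot adj theta B s v) ->
  0 < al < 1 -> al * (2 * D%:R) <= (1 - al) * theta -> 0 <= X ->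
  2 `^ (al * X) * (\sum_(t | X < (height s t)%:R) growth_law R adj s i t) <=
  #|T|%:R * B.
Proof.
move=> sym irr deg pot al01 al_le X0.
pose long v t := [exists p : #|T|.-bseq T,
      [&& root_path s t p, last s p == v & X < (size p)%:R]].
apply: le_trans (_ : \sum_v 2 `^ (al * X) *
    \sum_(t | long v t) growth_law R adj s i t <= _); last first.
  apply: le_trans (_ : \sum_(v : T) B <= _).
    by apply: ler_sum => v _; apply: endpoint_tail deg _ _ _.
  by rewrite sumr_const mulr_natl.
rewrite -mulr_sumr; apply: ler_wpM2l; first exact: powR_ge0.
under [leRHS]eq_bigr do rewrite big_mkcond.
rewrite exchange_big /= big_mkcond; apply: ler_sum => t _.
have law0 := growth_law_ge0 R adj s i t.
case: ifP => [Xh|_]; last by apply: sumr_ge0 => v _; case: ifP.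
have [|p pt szp] := @height_attained _ s t.
  by rewrite -(ltr_nat R) (le_lt_trans X0).
have szT := ltnW (size_root_path pt).
apply: le_trans (@sum_ge_term _ _ xpredT _ (last s p) _ _) => //=; last first.
  by move=> v _; case: ifP.
rewrite ifT//; apply/existsP; exists (Bseq szT).
by rewrite /= pt eqxx szp.
Qed.

(** * The grid *)

Lemma grid_adj_sym (R : realType) (d k : nat) : symmetric (@grid_adj R d k).
Proof.
have half x y : @grid_adj R d k x y -> @grid_adj R d k y x.
  case/grid_adjP=> i xyi eq_xy; apply/grid_adjP.
  by exists i; [rewrite near_val_sym|move=> j /eq_xy].
by move=> x y; apply/idP/idP; apply: half.
Qed.

Lemma grid_adj_irr (R : realType) (d k : nat) : irreflexive (@grid_adj R d k).
Proof. by move=> x; apply/grid_adjP => -[i /near_val_neq/eqP]. Qed.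

Lemma grid_degree (R : realType) (d k : nat) (x : grid_vertex d k) :
  (#|[set y | @grid_adj R d k x y]| <= 2 * d)%N.
Proof.
pose shifted (q : bool * 'I_d) : grid_vertex d k := [ffun j =>
  if j == q.2 then inord (if q.1 then (x j).+1 else (x j).-1) else x j].
apply: leq_trans (_ : #|[set shifted q | q : bool * 'I_d]| <= _)%N; last first.
  by rewrite (leq_trans (leq_imset_card _ _))// card_prod card_bool card_ord.
apply/subset_leq_card/subsetP => y; rewrite inE => /grid_adjP[i near_i eq_xy].
apply/imsetP; exists ((x i < y i)%N, i) => //; apply/ffunP => j; rewrite ffunE /=.
have [->|/eq_xy//] := eqVneq j i.
have yi := ltn_ord (y i); have xi := ltn_ord (x i).
apply/ord_inj; rewrite inordK; move: near_i yi xi; rewrite /near_val.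
  by move: (nat_of_ord (x i)) (nat_of_ord (y i)) => a b; case: (ltnP a b); lia.
by move: (nat_of_ord (x i)) (nat_of_ord (y i)) => a b; case: (ltnP a b); lia.
Qed.

Definition grid_dist (d k : nat) (x y : grid_vertex d k) : nat :=
  (\sum_i ((x i - y i) + (y i - x i)))%N.

Lemma grid_dist_adj (R : realType) (d k : nat) (s x y : grid_vertex d k) :
  @grid_adj R d k x y -> (grid_dist s y <= (grid_dist s x).+1)%N.
Proof.
case/grid_adjP=> i near_i eq_xy; rewrite /grid_dist.
rewrite (bigD1 i)//= [in leqRHS](bigD1 i)//= -addSn.
rewrite (eq_bigr (fun j => (s j - x j) + (x j - s j))%N).
  rewrite leq_add2r; move: near_i; rewrite /near_val.
  by move: (nat_of_ord (x i)) (nat_of_ord (y i)) (nat_of_ord (s i)) => a b c; lia.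
by move=> j /eq_xy ->.
Qed.

Lemma grid_far (d k : nat) (s : grid_vertex d k) :
  exists v : grid_vertex d k, (d * k <= 2 * grid_dist s v)%N.
Proof.
exists [ffun i => if (2 * s i <= k)%N then ord_max else ord0].
rewrite /grid_dist big_distrr /= -[d in (d * k)%N]card_ord -sum_nat_const.
apply: leq_sum => i _; rewrite ffunE; have := ltn_ord (s i).
case: (leqP (2 * s i) k) => /=; move: (nat_of_ord (s i)) => a; lia.
Qed.

Lemma grid_path_size (R : realType) (d k : nat) (s : grid_vertex d k) t p :
  (forall x y, tree_adj t x y -> @grid_adj R d k x y) ->
  path (tree_adj t) s p -> (grid_dist s (last s p) <= size p)%N.
Proof.
move=> sub; elim/last_ind: p => [_|p x IHp].
  by rewrite /grid_dist big1// => i _; rewrite subnn.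
rewrite rcons_path last_rcons size_rcons => /andP[/IHp le_p /sub adj_x].
by apply: leq_trans (grid_dist_adj s adj_x) _.
Qed.

Definition grid_growing (R : realType) (d k : nat) (s : grid_vertex d k) (i : nat)
    (t : subgraph (grid_vertex d k)) : Prop :=
  growing s i t /\ forall x y, tree_adj t x y -> @grid_adj R d k x y.

Lemma grid_growing0 (R : realType) (d k : nat) (s : grid_vertex d k) :
  grid_growing R s 0 ([set s], finset.set0).
Proof. by split=> [|x y]; [exact: growing0|rewrite /tree_adj inE]. Qed.

Lemma grid_growingS (R : realType) (d k : nat) (s : grid_vertex d k) i t e :
  grid_growing R s i t -> e \in cut (@grid_adj R d k) t.1 ->
  grid_growing R s i.+1 (grow t e).
Proof.
move=> [gt sub] ec; split; first exact: growingS gt ec.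
move=> x y; rewrite /tree_adj /= => /setU1P[E|/sub//].
move: ec; rewrite inE => /and3P[e1 e2 adj_e].
have /setP/(_ e.1) := E; have /setP/(_ e.2) := E; have /setP/(_ x) := E.
have ne : e.2 != e.1 by apply: contraNneq e2 => ->.
rewrite !inE !eqxx !orbT /= => /esym/orP[]/eqP xe.
  by rewrite xe (negPf ne) /=; case: eqP => // <-.
rewrite xe eqxx [e.1 == e.2]eq_sym (negPf ne) /= => _; case: eqP => // <- _.
by rewrite grid_adj_sym.
Qed.

(** Connectedness of the grid comes for free: a potential with positive drift
    needs an edge that leaves the set. *)
Lemma grid_cut_gt0 (R : realType) (d k : nat) (s : grid_vertex d k) i t :
  (0 < d)%N -> (0 < k)%N -> growing s i t -> (i < #|grid_vertex d k|.-1)%N ->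
  (0 < #|cut (@grid_adj R d k) t.1|)%N.
Proof.
move=> d0 k0 [[st _] card_t _ _] i_lt; rewrite lt0n; apply/negP => /eqP/cards0_eq cut0.
have [v vt] : exists v, v \notin t.1.
  apply/existsP; rewrite -negb_forall; apply/negP => /forallP all_t.
  have : #|[set: grid_vertex d k]| = i.+1.
    by rewrite -card_t; apply: eq_card => v; rewrite inE all_t.
  by rewrite cardsT; lia.
have [F [_ bndF /(_ _ st vt)]] := grid_reach_pot R s v k0.
rewrite /drift (eq_bigl [in cut (@grid_adj R d k) t.1]); last first.
  by move=> p; rewrite [RHS]inE.
rewrite cut0 big_set0; apply/negP; rewrite -ltNge mulr_gt0//.
  by rewrite divr_gt0// ltr0n.
by case/andP: (bndF t.1) => /(lt_le_trans ltr01).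
Qed.

Lemma grid_height_ge (R : realType) (d k : nat) (s : grid_vertex d k) t :
  grid_growing R s #|grid_vertex d k|.-1 t -> (d * k <= 2 * height s t)%N.
Proof.
move=> [[_ card_t reach ext] sub]; have [v far_v] := grid_far s.
have vt : v \in t.1.
  have /eqP-> : t.1 == [set: grid_vertex d k]; last by rewrite inE.
  by rewrite eqEcard subsetT cardsT card_t prednK ?leqnn//; apply/card_gt0P; exists s.
have [p rp pv] := reach v vt; have [q pq] := ext p rp.
have [pt _] := andP rp.
apply: leq_trans far_v _; rewrite leq_mul2l /= -pv.
apply: leq_trans (grid_path_size sub pt) _.
by apply: leq_trans (height_ge pq); rewrite size_cat leq_addr.
Qed.

Local Open Scope classical_set_scope.
Local Open Scope ring_scope.

Theorem corollary2 (R : realType) :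
  exists (c1 c2 : R) (f : nat -> R),
    [/\ 0 < c1, c1 <= c2, f n @[n --> \oo] --> (0 : R) &
      forall d k : nat, (1 <= d)%N -> (1 <= k)%N ->
      forall s : grid_vertex d k,
        1 - f ((k + 1) ^ d)%N <=
        spanning_tree_prob R (@grid_adj R d k) s
          (fun t => c1 * (d * k)%:R <= (height s t)%:R <= c2 * (d * k)%:R)].
Proof.
have [al [al0 al1 al_small]] : exists al : R,
    [/\ 0 < al, al < 1 & al * 1104 <= 1 - al].
  by exists (1 / 2000); split; lra.
have al01 : 0 < al < 1 by rewrite al0 al1.
(* B is at most 2^(10dk) and n at most 2^(dk); 13 leaves a factor 4^(-dk) *)
exists 2^-1, (13 / al), (@harmonic R); split => //.
- by rewrite ler_pdivlMr//; lra.
- exact: cvg_harmonic.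
move=> d k d1 k1 s; rewrite /spanning_tree_prob /spanning_tree_law.
set law := growth_law R (@grid_adj R d k) s #|grid_vertex d k|.-1.
set m := (d * k)%N.
have sym := @grid_adj_sym R d k; have irr := @grid_adj_irr R d k.
have step := @grid_growingS R d k s; have start := grid_growing0 R s.
have mass : \sum_t law t = 1.
  apply: (growth_law_mass R sym irr start step) (leqnn _) => i u [gu _].
  exact: (grid_cut_gt0 R d1 k1 gu).
have low t : law t != 0 -> 2^-1 * m%:R <= (height s t)%:R :> R.
  move=> /(growth_law_ind sym irr start step)/grid_height_ge.
  by rewrite -/m -(ler_nat R) natrM; lra.
have tail : 4 ^+ m * (\sum_(t | 13 / al * m%:R < (height s t)%:R :> R) law t) <= 1.
  have := @height_tail R _ (@grid_adj R d k) s (2 * d) (d%:R / 276)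
    ((2 * 4 ^+ d.+1) ^+ (2 * k)) al (13 / al * m%:R)
    #|grid_vertex d k|.-1 sym irr (@grid_degree R d k)
    (fun v => grid_reach_pot R s v k1).
  move=> /(_ al01); rewrite -/law => /(_ _ _).
  have -> : al * (13 / al * m%:R) = (13 * m)%:R :> R.
    by rewrite natrM mulrA mulrCA mulfV ?gt_eqF// mulr1.
  rewrite powR_mulrn// => H.
  have /H{H}H : al * (2 * (2 * d)%:R) <= (1 - al) * (d%:R / 276) :> R.
    have al_d := ler_wpM2r (ler0n R d) al_small.
    by rewrite natrM [leRHS]mulrA ler_pdivlMr//; lra.
  have /H{H} : 0 <= 13 / al * m%:R :> R by rewrite mulr_ge0// divr_ge0// ltW.
  set S := \sum_(_ | _) _ => H.
  have bnd : #|grid_vertex d k|%:R * (2 * 4 ^+ d.+1) ^+ (2 * k) <= 2 ^+ (11 * m) :> R.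
    have -> : 2 * 4 ^+ d.+1 = 2 ^+ (2 * d + 3) :> R.
      rewrite (_ : 4 = 2 ^+ 2); last by ring.
      by rewrite -exprM -exprS; congr (_ ^+ _); lia.
    rewrite -exprM -!natrX -natrM ler_nat card_ffun !card_ord.
    apply: leq_trans (_ : (2 ^ k) ^ d * 2 ^ ((2 * d + 3) * (2 * k)) <= _)%N.
      by rewrite leq_mul2r leq_exp2r// ltn_expl// orbT.
    by rewrite -expnM -expnD leq_exp2l// /m; nia.
  have := le_trans H bnd; rewrite (_ : (13 = 11 + 2)%N)// mulnDl exprD -mulrA.
  rewrite -[leRHS]mulr1 ler_pM2l ?exprn_gt0// exprM.
  by rewrite (_ : 2 ^+ 2 = 4)//; ring.
apply: le_trans (_ : 1 - \sum_(t | 13 / al * m%:R < (height s t)%:R :> R) law t <= _).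
  rewrite lerD2l lerN2 /harmonic.
  rewrite -[leRHS]mul1r -ler_pdivrMr ?invr_gt0 ?ltr0n// invrK.
  apply: le_trans tail; rewrite mulrC; apply: ler_wpM2r.
    by apply: sumr_ge0 => t _; apply: growth_law_ge0.
  rewrite -natrX ler_nat addn1.
  apply: leq_ltn_trans (_ : (2 ^ k) ^ d < _)%N; first by rewrite leq_exp2r// ltn_expl.
  by rewrite -expnM mulnC ltn_exp2r// muln_gt0 d1.
rewrite lerBlDr -[leLHS]mass.
rewrite [leLHS](bigID (fun t : subgraph (grid_vertex d k) =>
  2^-1 * m%:R <= ((height s t)%:R : R) <= 13 / al * m%:R)) /= lerD2l.
rewrite big_mkcond [leRHS]big_mkcond; apply: ler_sum => t _.
have law0 : 0 <= law t by exact: growth_law_ge0.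
have [->|law_t] := eqVneq (law t) 0; first by rewrite !if_same.
by rewrite low//= -ltNge.
Qed.
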